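(* Let $\mathcal{P}$ be an imprecise probability tree and $\overline{\mathrm{Q}}$ an upper expectation tree that agree. Let $s\in\mathcal{X}^*$ be any situation and let $f\in\overline{\mathbb{V}}$ be any global variable that is the pointwise limit of a non-decreasing or non-increasing sequence of finitary gambles. Then $\overline{\mathrm{E}}_{\mathcal{P}}(f\mid s)=\overline{\mathrm{E}}_{\overline{\mathrm{Q}}}(f\mid s)$.
   Context: **Basics.** $\mathcal{X}$ is a fixed non-empty finite set (state space), $\mathbb{N}=\{1,2,\dots\}$, $\mathbb{N}_0=\mathbb{N}\cup\{0\}$. A situation is a finite sequence $x_{1:k}=x_1\cdots x_k\in\mathcal{X}^k$, $k\in\mathbb{N}_0$; $\mathcal{X}^*=\bigcup_{k\in\mathbb{N}_0}\mathcal{X}^k$ is the set of all situations and $\square=x_{1:0}$ is the empty one. $\Omega=\mathcal{X}^{\mathbb{N}}$ is the set of paths; for $\omega=x_1x_2\cdots\in\Omega$, $\omega^k=x_{1:k}$. $\Gamma(x_{1:k})=\{\omega\in\Omega:\omega^k=x_{1:k}\}$ is a cylinder event, and $\mathcal{F}$ is the $\sigma$-algebra on $\Omega$ generated by all cylinder events. $\overline{\mathbb{R}}=\mathbb{R}\cup\{\pm\infty\}$. A variable on a non-empty set $Y$ is a map $Y\to\overline{\mathbb{R}}$; a gamble is a bounded (hence real-valued) variable. $\mathcal{L}(\mathcal{X})$ is the set of all maps $\mathcal{X}\to\mathbb{R}$; $\overline{\mathbb{V}}$ and $\mathbb{V}$ are the sets of all variables, respectively all gambles, on $\Omega$ (global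 variables, global gambles); $\overline{\mathbb{V}}_{\mathrm b}$ is the set of all bounded below elements of $\overline{\mathbb{V}}$. A global variable $f$ is finitary if there are $n\in\mathbb{N}$ and $g:\mathcal{X}^n\to\overline{\mathbb{R}}$ with $f(\omega)=g(\omega^n)$ for all $\omega$; $\mathbb{F}$ is the set of finitary gambles. $X_n$ is the projection $\omega\mapsto\omega_n$ (the $n$-th state value) and $X_{1:n}$ the projection $\omega\mapsto\omega^n$. $\mathbb{I}_s$ is the indicator of $\Gamma(s)$. Limits and inequalities of variables are pointwise. A global upper expectation is a map $\overline{\mathrm{E}}:\overline{\mathbb{V}}\times\mathcal{X}^*\to\overline{\mathbb{R}}$, $(f,s)\mapsto\overline{\mathrm{E}}(f\mid s)$. **Trees.** A precise probability tree $p$ assigns to each $s\in\mathcal{X}^*$ a probability mass function $p(\cdot\mid s)$ on $\mathcal{X}$. An imprecise probability tree $\mathcal{P}$ assigns to each $s\in\mathcal{X}^*$ a credal set $\mathcal{P}_s$, i.e. a non-empty closed (for pointwise convergence) convex set of probability mass functions on $\mathcal{X}$. $p$ is compatible with $\mathcal{P}$, written $p\sim\mathcal{P}$, if $p(\cdot\mid s)\in\mathcal{P}_s$ for all $s$. An upper expectation tree $\overline{\mathrm{Q}}$ assigns to each $s\in\mathcal{X}^*$ a map $\overline{\mathrm{Q}}_s:\mathcal{L}(\mathcal{X})\to\mathbb{R}$ such that $\overline{\mathrm{Q}}_s(f)\le\sup f$, $\overline{\mathrm{Q}}_s(f+g)\le\overline{\mathrm{Q}}_s(f)+\overline{\mathrm{Q}}_s(g)$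 and $\overline{\mathrm{Q}}_s(\lambda f)=\lambda\overline{\mathrm{Q}}_s(f)$ for all $f,g\in\mathcal{L}(\mathcal{X})$ and real $\lambda\ge0$. $\mathcal{P}$ and $\overline{\mathrm{Q}}$ agree if $\overline{\mathrm{Q}}_s(f)=\sup\{\sum_{x\in\mathcal{X}}f(x)p(x\mid s):p(\cdot\mid s)\in\mathcal{P}_s\}$ for all $s\in\mathcal{X}^*$ and $f\in\mathcal{L}(\mathcal{X})$; equivalently, for all $s$, $\mathcal{P}_s$ is the set of all mass functions $q$ on $\mathcal{X}$ with $\sum_x f(x)q(x)\le\overline{\mathrm{Q}}_s(f)$ for all $f\in\mathcal{L}(\mathcal{X})$ (this is a one-to-one correspondence). **Measure-theoretic upper expectation $\overline{\mathrm{E}}_{\mathcal{P}}$.** For a precise tree $p$ and a situation $x_{1:k}$, $\mathrm{P}_p(\cdot\mid x_{1:k})$ is the unique probability measure on $\mathcal{F}$ such that, for every situation $z_{1:\ell}$, $\mathrm{P}_p(\Gamma(z_{1:\ell})\mid x_{1:k})$ equals $\prod_{i=k}^{\ell-1}p(z_{i+1}\mid z_{1:i})$ if $k<\ell$ and $z_{1:k}=x_{1:k}$; equals $1$ if $k\ge\ell$ and $z_{1:\ell}=x_{1:\ell}$; and equals $0$ otherwise. $\mathrm{E}_p(f\mid s)=\int_\Omega f\,d\mathrm{P}_p(\cdot\mid s)$ whenever this Lebesgue integral exists (in particular if $f$ is $\mathcal{F}$-measurable and bounded below or bounded above). For all $f\in\overline{\mathbb{V}}$, $\overline{\mathrm{E}}_p(f\mid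 s)=\inf\{\mathrm{E}_p(g\mid s): g\in\overline{\mathbb{V}}\text{ bounded below and }\mathcal{F}\text{-measurable},\ g\ge f\}$, and $\overline{\mathrm{E}}_{\mathcal{P}}(f\mid s)=\sup\{\overline{\mathrm{E}}_p(f\mid s):p\sim\mathcal{P}\}$. **Game-theoretic/axiomatic upper expectation $\overline{\mathrm{E}}_{\overline{\mathrm{Q}}}$.** A supermartingale (for $\overline{\mathrm{Q}}$) is a map $\mathcal{M}:\mathcal{X}^*\to\mathbb{R}$ with $\overline{\mathrm{Q}}_s(\mathcal{M}(s\,\cdot))\le\mathcal{M}(s)$ for all $s$, where $\mathcal{M}(s\,\cdot)$ is $x\mapsto\mathcal{M}(sx)$; $\mathbb{M}_{\mathrm b}(\overline{\mathrm{Q}})$ is the set of bounded below supermartingales; $\liminf\mathcal{M}(\omega)=\liminf_{k\to\infty}\mathcal{M}(\omega^k)$. For a global gamble $f\in\mathbb{V}$ put $\overline{\mathrm{E}}_{\mathrm{G},\overline{\mathrm{Q}}}(f\mid s)=\inf\{\mathcal{M}(s):\mathcal{M}\in\mathbb{M}_{\mathrm b}(\overline{\mathrm{Q}}),\ \liminf\mathcal{M}(\omega)\ge f(\omega)\text{ for all }\omega\in\Gamma(s)\}$. This is extended uniquely to $\overline{\mathbb{V}}\times\mathcal{X}^*$ by $\overline{\mathrm{E}}_{\mathrm{G},\overline{\mathrm{Q}}}(f\mid s)=\lim_{c\to+\infty}\overline{\mathrm{E}}_{\mathrm{G},\overline{\mathrm{Q}}}(\min\{f,c\}\mid s)$ for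 $f\in\overline{\mathbb{V}}_{\mathrm b}$, and $\overline{\mathrm{E}}_{\mathrm{G},\overline{\mathrm{Q}}}(f\mid s)=\lim_{c\to-\infty}\overline{\mathrm{E}}_{\mathrm{G},\overline{\mathrm{Q}}}(\max\{f,c\}\mid s)$ for $f\in\overline{\mathbb{V}}$. The axiomatic model $\overline{\mathrm{E}}_{\mathrm{A},\overline{\mathrm{Q}}}$ is the (pointwise) largest global upper expectation $\overline{\mathrm{E}}$ satisfying: P1. $\overline{\mathrm{E}}(f(X_{n+1})\mid x_{1:n})=\overline{\mathrm{Q}}_{x_{1:n}}(f)$ for all $f\in\mathcal{L}(\mathcal{X})$, $x_{1:n}\in\mathcal{X}^*$; P2. $\overline{\mathrm{E}}(f\mid s)=\overline{\mathrm{E}}(f\mathbb{I}_s\mid s)$ for all $f\in\mathbb{F}$, $s\in\mathcal{X}^*$; P3. $\overline{\mathrm{E}}(f\mid X_{1:k})\le\overline{\mathrm{E}}(\overline{\mathrm{E}}(f\mid X_{1:k+1})\mid X_{1:k})$ for all $f\in\mathbb{F}$, $k\in\mathbb{N}_0$, where $\overline{\mathrm{E}}(f\mid X_{1:k})$ is the variable $\omega\mapsto\overline{\mathrm{E}}(f\mid\omega^k)$; P4. $f\le g$ implies $\overline{\mathrm{E}}(f\mid s)\le\overline{\mathrm{E}}(g\mid s)$ for all $f,g\in\overline{\mathbb{V}}$, $s\in\mathcal{X}^*$; P5. for any sequence $(f_n)$ of finitary gambles that is uniformly bounded below and converges pointwise to $f$, $\limsup_n\overline{\mathrm{E}}(f_n\mid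 s)\ge\overline{\mathrm{E}}(f\mid s)$ for all $s\in\mathcal{X}^*$. It is known (earlier work) that this largest model exists and that $\overline{\mathrm{E}}_{\mathrm{A},\overline{\mathrm{Q}}}=\overline{\mathrm{E}}_{\mathrm{G},\overline{\mathrm{Q}}}$; the common operator is denoted $\overline{\mathrm{E}}_{\overline{\mathrm{Q}}}$. *)

(* Defs.v *)
From HB Require Import structures.
From mathcomp Require Import all_boot all_order all_algebra.
From mathcomp Require Import all_classical all_reals all_analysis.
From mathcomp Require Import measurable_realfun.

Set Implicit Arguments.
Unset Strict Implicit.
Unset Printing Implicit Defensive.

Import Order.TTheory GRing.Theory Num.Theory.
Import numFieldNormedType.Exports.

Local Open Scope classical_set_scope.
Local Open Scope ring_scope.

(* Non-empty finite state spaces: the distinguished point only witnesses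
   non-emptiness. *)
#[short(type="pfinType")]
HB.structure Definition PointedFinite := {T of Finite T & isPointed T}.

Section Paths.
Context (X : pfinType).

Definition situation : Type := seq X.

(* Indices are shifted by one: [w n] is the state X_{n+1}. *)
Definition paths : Type := nat -> X.

Definition history (w : paths) (k : nat) : situation := mkseq w k.

Definition cylinder (s : situation) : set paths :=
  [set w | history w (size s) = s].

Definition cylinders : set (set paths) := range cylinder.

(* The paths, equipped with the sigma-algebra generated by the cylinders. *)
Definition mpath := g_sigma_algebraType cylinders.

End Paths.

Section Variables.
Context (R : realType) (X : pfinType).
Implicit Types f : paths X -> \bar R.

Definition bounded_below f := exists c : R, forall w, (c%:E <= f w)%E.

Definition gamble f := exists c : R, forall w, (`|f w| <= c%:E)%E.

Definition finitary f := exists n : nat, (0 < n)%N /\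
  exists g : n.-tuple X -> \bar R, forall w, f w = g [tuple w i | i < n].

Definition finitary_gamble f := finitary f /\ gamble f.

(* A global upper expectation; [E f s] stands for E(f | s). *)
Definition global_upexp : Type :=
  (paths X -> \bar R) -> situation X -> \bar R.

End Variables.

Section Trees.
Context (R : realType) (X : pfinType).

Definition mass_function (q : X -> R) := (forall x, 0 <= q x) /\ \sum_x q x = 1.

Definition precise_tree (p : situation X -> X -> R) := forall s, mass_function (p s).

Definition credal_set (C : set (X -> R)) :=
  [/\ C !=set0, C `<=` mass_function,
      closed (C : set {ptws X -> R}) &
      convex_set (C : set (convex_lmodType (X -> R^o)))].

Definition imprecise_tree (P : situation X -> set (X -> R)) :=
  forall s, credal_set (P s).

Definition compatible (p : situation X -> X -> R)
    (P : situation X -> set (X -> R)) :=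
  precise_tree p /\ forall s, P s (p s).

Definition local_upexp (U : (X -> R) -> R) :=
  [/\ forall f, U f <= sup (range f),
      forall f g, U (fun x => f x + g x) <= U f + U g &
      forall (a : R) f, 0 <= a -> U (fun x => a * f x) = a * U f].

Definition upexp_tree (Q : situation X -> (X -> R) -> R) :=
  forall s, local_upexp (Q s).

Definition agree (P : situation X -> set (X -> R))
    (Q : situation X -> (X -> R) -> R) :=
  forall s f, Q s f = sup [set \sum_x f x * q x | q in P s].

End Trees.

Section MeasureTheoretic.
Context (R : realType) (X : pfinType).

Definition cylinder_prob (p : situation X -> X -> R) (x z : situation X) : R :=
  if (size x < size z)%N && (take (size x) z == x) then
    \prod_(size x <= i < size z) p (take i z) (nth point z i)
  else if (size z <= size x)%N && (take (size z) x == z) then 1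
  else 0.

(* Definite description: for a precise tree [p] there is exactly one such
   probability measure. *)
Definition path_measure (p : situation X -> X -> R) (x : situation X) :
    probability (mpath X) R :=
  get [set mu : probability (mpath X) R |
    forall z, mu (cylinder z) = (cylinder_prob p x z)%:E].

Definition upexp_precise (p : situation X -> X -> R) : global_upexp R X :=
  fun f s => ereal_inf
    [set (\int[path_measure p s]_w g w)%E | g in
      [set g : mpath X -> \bar R |
        [/\ bounded_below g, measurable_fun [set: mpath X] g &
            forall w, (f w <= g w)%E]]].

Definition upexp_measure (P : situation X -> set (X -> R)) :
    global_upexp R X :=
  fun f s => ereal_sup [set upexp_precise p f s | p in
    [set p | compatible p P]].

End MeasureTheoretic.

Section GameTheoretic.
Context (R : realType) (X : pfinType) (Q : situation X -> (X -> R) -> R).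

Definition supermartingale (M : situation X -> R) :=
  forall s, Q s (fun x => M (rcons s x)) <= M s.

Definition bounded_below_supermartingale (M : situation X -> R) :=
  supermartingale M /\ exists c : R, forall s, c <= M s.

(* The formula for global gambles. *)
Definition upexp_game_gamble : global_upexp R X :=
  fun f s => ereal_inf [set (M s)%:E | M in
    [set M | bounded_below_supermartingale M /\
      forall w, cylinder s w ->
        (f w <= limn_einf (fun k => (M (history w k))%:E))%E]].

(* Extension from gambles to bounded below variables by upper cuts. *)
Definition upexp_game_bb : global_upexp R X :=
  fun f s =>
    lim (upexp_game_gamble (fun w => mine (f w) c%:E) s @[c --> (+oo : set_system R)]).

(* Extension to all variables by lower cuts. On gambles both extensions have
   no effect, and on bounded below variables this one has none, since the cuts
   are then eventually trivial. *)
Definition upexp_game : global_upexp R X :=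
  fun f s =>
    lim (upexp_game_bb (fun w => maxe (f w) c%:E) s @[c --> (-oo : set_system R)]).

End GameTheoretic.

Section Axiomatic.
Context (R : realType) (X : pfinType) (Q : situation X -> (X -> R) -> R).
Implicit Type E : global_upexp R X.

Record upexp_axioms E : Prop := {
  upexp_local : forall (f : X -> R) s,
    E (fun w => (f (w (size s)))%:E) s = (Q s f)%:E ;
  upexp_conditional : forall f s, finitary_gamble f ->
    E f s = E (fun w => f w * (\1_(cylinder s) w)%:E)%E s ;
  upexp_iterated : forall f k (w : paths X), finitary_gamble f ->
    (E f (history w k)
       <= E (fun w' => E f (history w' k.+1)) (history w k))%E ;
  upexp_monotone : forall f g s, (forall w, (f w <= g w)%E) ->
    (E f s <= E g s)%E ;
  upexp_continuous : forall (f_ : nat -> paths X -> \bar R) f s,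
    (forall n, finitary_gamble (f_ n)) ->
    (exists c : R, forall n w, (c%:E <= f_ n w)%E) ->
    (forall w, f_ ^~ w @ \oo --> f w) ->
    (E f s <= limn_esup (fun n => E (f_ n) s))%E
}.

Definition upexp_axiomatic E :=
  upexp_axioms E /\
  forall E', upexp_axioms E' -> forall f s, (E' f s <= E f s)%E.

End Axiomatic.

(* Main.v *)
(** For a finitary gamble both upper expectations are computed by the backward
    recursion [V t = Q_t (V (t .))]. Non-decreasing limits follow by monotone
    convergence on the measure side, while on the game side [sup_n V_n], cut at
    a constant, is a supermartingale dominating the limit. For non-increasing
    limits, compactness of each credal set yields, situation by situation, a
    mass function that is optimal for the limit of the [V_n]; the resulting
    compatible tree attains [inf_n V_n]. The game-theoretic model dominates the
    measure-theoretic one by Fatou's lemma applied to supermartingales. Finally,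
    the measure-theoretic model satisfies P1-P5, hence lies below the largest
    such model, and P1-P3 force every such model below the recursion on finitary
    gambles. *)
From HB Require Import structures.
Require Import Defs.
From mathcomp Require Import all_boot all_order all_algebra.
From mathcomp Require Import all_classical all_reals all_analysis.
From mathcomp Require Import measurable_realfun.
From mathcomp Require Import zify lra.
Import Order.TTheory GRing.Theory Num.Theory.
Import numFieldNormedType.Exports.

Set Implicit Arguments.
Unset Strict Implicit.
Unset Printing Implicit Defensive.

Local Open Scope classical_set_scope.
Local Open Scope ring_scope.

(** The induction suited to backward recursions: its base lies beyond the depth where a gamble is
    determined, and its step runs from the children to their parent. *)
Lemma size_down_ind (X : Type) (N : nat) (A : seq X -> Prop) :
  (forall t, (N <= size t)%N -> A t) ->
  (forall t, (forall x, A (rcons t x)) -> A t) -> forall t, A t.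
Proof.
move=> Abase Astep t; have [k] := ubnP (N - size t).
elim: k t => // k IHk t lek; have [/Abase //|ltN] := leqP N (size t).
by apply: Astep => x; apply: IHk; rewrite size_rcons; lia.
Qed.

(** * Histories and cylinders *)

Section Histories.
Context {X : pfinType}.
Implicit Types (w : paths X) (t : situation X).

Lemma size_history w k : size (history w k) = k.
Proof. exact: size_mkseq. Qed.

Lemma historyS w k : history w k.+1 = rcons (history w k) (w k).
Proof. by rewrite /history mkseqS. Qed.

Lemma nth_history w k i : (i < k)%N -> nth point (history w k) i = w i.
Proof. by move=> ltik; rewrite nth_mkseq. Qed.

Lemma take_history w i k : (i <= k)%N -> take i (history w k) = history w i.
Proof.
move=> leik; apply: (@eq_from_nth _ point).
  by rewrite size_takel !size_history.
move=> j; rewrite size_takel ?size_history// => ltji.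
by rewrite nth_take// !nth_history// (leq_trans ltji).
Qed.

Lemma cylinder_nth t : cylinder t (nth point t).
Proof. by rewrite /cylinder /= /history mkseq_nth. Qed.

Lemma cylinder_history w k : cylinder (history w k) w.
Proof. by rewrite /cylinder /= size_history. Qed.

Lemma cylinder_rcons t x w : cylinder (rcons t x) w <-> cylinder t w /\ w (size t) = x.
Proof.
rewrite /cylinder /= size_rcons historyS; split=> [/rcons_inj[-> ->]//|].
by move=> [-> ->].
Qed.

End Histories.

(** * Local expectations: linear means and their upper envelopes *)

Section LocalOperators.
Context {R : realType} {X : pfinType}.
Implicit Types (U : (X -> R) -> R) (u v q : X -> R).

(** The inequality with [c] packs monotonicity and constant additivity into one condition, shared by
    linear means and upper expectations. *)
Definition translation_monotone U :=
  U (fun=> 0) = 0 /\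
  forall u v (c : R), (forall x, u x <= v x + c) -> U u <= U v + c.

Lemma tmono_le U u v : translation_monotone U ->
  (forall x, u x <= v x) -> U u <= U v.
Proof.
by move=> [_ Ule] uv; rewrite -[U v]addr0; apply: Ule => x; rewrite addr0.
Qed.

Lemma tmono_cst U a : translation_monotone U -> U (fun=> a) = a.
Proof.
move=> [U0 Ule]; apply/eqP; rewrite eq_le; apply/andP; split.
  rewrite -[leRHS]add0r -U0; apply: Ule => x; lra.
suff : U (fun=> 0) <= U (fun=> a) + (- a) by rewrite U0; lra.
by apply: Ule => x; lra.
Qed.

Definition mean q u : R := \sum_x u x * q x.

Lemma mean_tmono q : mass_function q -> translation_monotone (mean q).
Proof.
move=> [q0 q1]; split=> [|u v c uv].
  by rewrite /mean big1// => x _; rewrite mul0r.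
rewrite -[X in _ + X]mulr1 -q1 mulr_sumr -big_split/=.
by apply: ler_sum => x _; rewrite -mulrDl ler_wpM2r.
Qed.

Variables (C : set (X -> R)) (U : (X -> R) -> R).
Hypotheses (hC : credal_set C)
  (hU : forall u, U u = sup [set mean q u | q in C]).

Lemma mass_function_le1 q x : mass_function q -> q x <= 1.
Proof.
by move=> [q0 <-]; rewrite (bigD1 x)//= lerDl; apply: sumr_ge0 => y _.
Qed.

Let has_sup_mean u : has_sup [set mean q u | q in C].
Proof.
case: hC => -[q0 Cq0] Cmass _ _; split; first by exists (mean q0 u), q0.
exists (\sum_x `|u x|) => _ [q /Cmass mq <-]; apply: ler_sum => x _.
apply: le_trans (ler_norm _) _; rewrite normrM ler_piMr//.
by rewrite ger0_norm; [exact: mass_function_le1|case: mq].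
Qed.

Lemma mean_le_upper q u : C q -> mean q u <= U u.
Proof. by move=> Cq; rewrite hU; apply: ub_le_sup; [case: (has_sup_mean u)|exists q]. Qed.

Lemma mean_approx_upper u e : 0 < e -> exists2 q, C q & U u <= mean q u + e.
Proof.
move=> e0; have [_ [q Cq <-] ltq] := sup_adherent e0 (has_sup_mean u).
by exists q => //; rewrite hU; lra.
Qed.

(** Inherited from the linear means over [C], since each supremum is approached by a mean within any
    [e]. *)
Lemma upper_tmono : translation_monotone U.
Proof.
have Cmass q : C q -> mass_function q by case: hC => _ + _ _; exact.
have [[q0 Cq0] _ _ _] := hC; split=> [|u v c uv].
  apply/eqP; rewrite eq_le; apply/andP; split; last first.
    apply: le_trans (mean_le_upper (fun=> 0) Cq0).
    by rewrite (mean_tmono (Cmass _ Cq0)).1.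
  apply/ler_addgt0Pr => e e0; have [q Cq] := mean_approx_upper (fun=> 0) e0.
  by rewrite (mean_tmono (Cmass _ Cq)).1.
apply/ler_addgt0Pr => e e0; have [q Cq leq] := mean_approx_upper u e0.
have := (mean_tmono (Cmass _ Cq)).2 u v c uv.
by have := mean_le_upper v Cq; lra.
Qed.

End LocalOperators.

(** * Backward recursion for finitary gambles *)

Section TreeValues.
Context {R : realType} {X : pfinType}.
Implicit Types (f g : paths X -> \bar R) (V W : situation X -> R).
Implicit Types (U : situation X -> (X -> R) -> R) (t s : situation X).

(** A relation rather than a function, so that it serves both [Q] and the means of a precise tree.
    The terminal condition holds at all depths from [N] on, which lets gambles of different depths
    be compared at a common level. *)
Definition tree_value U f V :=
  (forall t, V t = U t (fun x => V (rcons t x))) /\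
  exists N, forall k w, (N <= k)%N -> f w = (V (history w k))%:E.

Lemma finitary_gamble_history V N :
  finitary_gamble (fun w : paths X => (V (history w N))%:E).
Proof.
have historyE w : history w N.+1 = [tuple w i | i < N.+1].
  by rewrite /history /mkseq -val_enum_ord -map_comp.
split.
  (* The depth is raised by one because [finitary] asks for a positive one and [N] may be zero. *)
  exists N.+1; split => //; exists (fun z => (V (take N z))%:E) => w.
  by rewrite -historyE take_history.
pose c := \sum_(z : N.+1.-tuple X) `|V (take N z)|; exists c => w.
rewrite -(take_history w (leqnSn N)) historyE lee_fin /c.
by rewrite (bigD1 [tuple w i | i < N.+1])//= lerDl; apply: sumr_ge0.
Qed.

Lemma tree_value_finitary_gamble U f V : tree_value U f V -> finitary_gamble f.
Proof.
move=> [_ [N fV]]; have -> : f = fun w => (V (history w N))%:E.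
  by apply/funext => w; exact: fV.
exact: finitary_gamble_history.
Qed.

(** [B k] performs [k] steps of the recursion, and [n - size t] of them remain at [t]. Beyond depth
    [n] the value is the same at all children, and [U t] must return this constant: this is where
    translation monotonicity enters. *)
Lemma tree_value_exists U f : (forall t, translation_monotone (U t)) ->
  finitary_gamble f -> exists V, tree_value U f V.
Proof.
move=> hU [[n [n0 [g fg]]] [c fc]].
have ffin w : f w = (fine (f w))%:E.
  by rewrite fineK// fin_numElt; have := fc w; case: (f w) => //= r _; rewrite ltNyr ltry.
(* [f] is read on the path that pads [t] with the default state; once [t] has length [n], the
   padding does not affect the value. *)
pose h t := fine (f (nth point t)).
pose fix B (k : nat) (t : situation X) {struct k} : R :=
  if k is k'.+1 then U t (fun x => B k' (rcons t x)) else h t.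
have heq t t' : take n t = take n t' -> (n <= size t)%N -> (n <= size t')%N -> h t = h t'.
  move=> tt' lt lt'; rewrite /h !fg; congr (fine (g _)); apply: eq_mktuple => i.
  by rewrite -(@nth_take n)// tt' nth_take.
exists (fun t => B (n - size t)%N t); split=> [t|].
  have [len|ltn] := leqP n (size t); last first.
    have -> : (n - size t = (n - (size t).+1).+1)%N by lia.
    by rewrite /=; congr (U t _); apply/funext => x; rewrite size_rcons.
  have -> : (n - size t = 0)%N by lia.
  rewrite -[LHS](tmono_cst _ (hU t)); congr (U t _); apply/funext => x.
  rewrite size_rcons; have -> : (n - (size t).+1 = 0)%N by lia.
  by apply: heq => //; [rewrite -cats1 takel_cat|rewrite size_rcons; lia].
exists n => k w lenk; rewrite size_history.
have -> : (n - k = 0)%N by lia.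
rewrite /= /h ffin; congr (fine _)%:E; rewrite !fg; congr (g _).
by apply: eq_mktuple => i; rewrite nth_history// (leq_trans _ lenk).
Qed.

(** Two families of operators are allowed so that a precise tree can be compared with [Q]. The order
    on the cylinder of [t] suffices, because the recursion at [t] visits only extensions of [t]. *)
Lemma tree_value_le U U' f g V W t : tree_value U f V -> tree_value U' g W ->
  (forall t u v, (forall x, u x <= v x) -> U t u <= U' t v) ->
  (forall w, cylinder t w -> (f w <= g w)%E) -> V t <= W t.
Proof.
move=> [VE [N fV]] [WE [M gW]] UU'.
elim/(@size_down_ind X (maxn N M)) : t => [t|t IHt fg].
  rewrite geq_max => /andP[leN leM] fg.
  have ct := cylinder_nth t; have := fg _ ct.
  by rewrite (fV _ _ leN) (gW _ _ leM) lee_fin ct.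
rewrite VE WE; apply: UU' => x; apply: IHt => w.
by move=> /cylinder_rcons[+ _]; exact: fg.
Qed.

Lemma tree_value_eq U f g V W t : (forall t, translation_monotone (U t)) ->
  tree_value U f V -> tree_value U g W ->
  (forall w, cylinder t w -> f w = g w) -> V t = W t.
Proof.
move=> hU fV gW fg.
have Ule t' u v : (forall x, u x <= v x) -> U t' u <= U t' v by exact: tmono_le.
apply/eqP; rewrite eq_le; apply/andP; split.
  by apply: (tree_value_le fV gW) => // w ct; rewrite fg.
by apply: (tree_value_le gW fV) => // w ct; rewrite fg.
Qed.

Lemma tree_value_cst U (a : R) : (forall t, translation_monotone (U t)) ->
  tree_value U (fun=> a%:E) (fun=> a).
Proof. by move=> hU; split=> [t|]; [rewrite tmono_cst|exists 0%N]. Qed.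

End TreeValues.

(** * Construction of the measure of a precise tree from Lebesgue measure *)

Section PathMeasure.
Context {R : realType} {X : pfinType} (p : situation X -> X -> R).
Hypothesis hp : precise_tree p.
Implicit Types (t z : situation X) (u : R).

Let p_ge0 t x : 0 <= p t x. Proof. by case: (hp t). Qed.

Definition cylinder_mass z : R := \prod_(i < size z) p (take i z) (nth point z i).

Lemma cylinder_mass_nil : cylinder_mass [::] = 1.
Proof. exact: big_ord0. Qed.

Lemma cylinder_mass_rcons t x : cylinder_mass (rcons t x) = cylinder_mass t * p t x.
Proof.
rewrite /cylinder_mass size_rcons big_ord_recr/=; congr (_ * _).
  apply: eq_bigr => i _; rewrite nth_rcons ltn_ord; congr (p _ _).
  by rewrite -cats1 takel_cat// ltnW.
by rewrite nth_rcons ltnn eqxx -cats1 take_size_cat.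
Qed.

Lemma cylinder_mass_ge0 t : 0 <= cylinder_mass t.
Proof. by apply: prodr_ge0. Qed.

(* The interval of [t] is split, in the order given by [enum_rank], into the
   intervals of its children, with lengths proportional to [p t]. *)
Let cum t j : R := \sum_(x | (enum_rank x < j)%N) p t x.

(** The left endpoint of the interval of [t]: each step adds the share of the parent's interval
    taken by earlier siblings. *)
Let lo t : R := \sum_(i < size t)
  cylinder_mass (take i t) * cum (take i t) (enum_rank (nth point t i)).

Let cum_mono t i j : (i <= j)%N -> cum t i <= cum t j.
Proof.
move=> leij; rewrite /cum [leRHS](bigID (fun x => enum_rank x < i)%N)/=.
rewrite [X in _ <= X + _](eq_bigl (fun x => enum_rank x < i)%N); last first.
  move=> x; case: (ltnP (enum_rank x) i) => [ltxi|]; rewrite ?andbF//.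
  by rewrite andbT (leq_trans ltxi).
by rewrite lerDl; apply: sumr_ge0.
Qed.

Let cumS t x : cum t (enum_rank x).+1 = cum t (enum_rank x) + p t x.
Proof.
rewrite /cum (bigD1 x)//= addrC; congr (_ + _); apply: eq_bigl => y.
by rewrite ltnS ltn_neqAle andbC (inj_eq val_inj) (inj_eq enum_rank_inj).
Qed.

Let cum0 t : cum t 0 = 0.
Proof. exact: big_pred0. Qed.

Let cum_card t : cum t #|X| = 1.
Proof. by case: (hp t) => _ <-; apply: eq_bigl => x; rewrite ltn_ord. Qed.

Let lo_rcons t x : lo (rcons t x) = lo t + cylinder_mass t * cum t (enum_rank x).
Proof.
rewrite /lo size_rcons big_ord_recr/=; congr (_ + _).
  apply: eq_bigr => i _; rewrite nth_rcons ltn_ord.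
  by rewrite -cats1 takel_cat// ltnW.
by rewrite nth_rcons ltnn eqxx -cats1 take_size_cat.
Qed.

(** Half-open, so that the children partition their parent exactly; a child of mass zero gets the
    empty interval. *)
Let itv t u := lo t <= u < lo t + cylinder_mass t.

Let itv_rconsE t x u : itv (rcons t x) u =
  (lo t + cylinder_mass t * cum t (enum_rank x) <= u <
   lo t + cylinder_mass t * cum t (enum_rank x).+1).
Proof. by rewrite /itv lo_rcons cylinder_mass_rcons cumS mulrDr addrA. Qed.

Let split_mono t i j : (i <= j)%N ->
  lo t + cylinder_mass t * cum t i <= lo t + cylinder_mass t * cum t j.
Proof. by move=> leij; rewrite lerD2l ler_wpM2l ?cylinder_mass_ge0 ?cum_mono. Qed.

Let itv_rcons_sub t x u : itv (rcons t x) u -> itv t u.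
Proof.
rewrite itv_rconsE => /andP[le1 lt1]; apply/andP; split.
  by have := split_mono t (leq0n (enum_rank x)); rewrite cum0; lra.
have := @split_mono t (enum_rank x).+1 #|X| (ltn_ord _).
by rewrite cum_card; lra.
Qed.

Let itv_rcons_inj t x y u : itv (rcons t x) u -> itv (rcons t y) u -> x = y.
Proof.
wlog lexy : x y / (enum_rank x <= enum_rank y)%N => [hwlog|].
  have [/hwlog//|/ltnW/hwlog h] := leqP (enum_rank x) (enum_rank y).
  by move=> hx hy; rewrite h.
rewrite !itv_rconsE => /andP[_ ltu] /andP[leu _].
apply: enum_rank_inj; apply: val_inj; apply/eqP.
rewrite eqn_leq lexy leqNgt; apply/negP => /(split_mono t).
lra.
Qed.

Let itv_rcons_ex t u : itv t u -> exists x, itv (rcons t x) u.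
Proof.
move=> /andP[leu ltu].
have lt1 : exists j, u < lo t + cylinder_mass t * cum t j.
  by exists #|X|; rewrite cum_card mulr1.
(* The child sought is the first one whose right end exceeds [u]; minimality puts [u] at or after
   its left end. *)
case: (ex_minnP lt1) => -[|j]; first by rewrite cum0; lra.
move=> ltj minj.
have ltjX : (j < #|X|)%N.
  by apply: minj; rewrite cum_card mulr1.
exists (enum_val (Ordinal ltjX)); rewrite itv_rconsE enum_valK ltj andbT.
by rewrite leNgt; apply/negP => /minj; rewrite ltnn.
Qed.

(** Along the path of a point of [[0, 1)] some child interval always contains [u]; the default state
    serves the other reals. *)
Let next u t := odflt point [pick x | itv (rcons t x) u].

Let Fixpoint hist u k :=
  if k is k'.+1 then rcons (hist u k') (next u (hist u k')) else [::].

Let path_of u : mpath X := fun k => next u (hist u k).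

Let history_path_of u k : history (path_of u) k = hist u k.
Proof. by elim: k => // k IHk; rewrite historyS IHk. Qed.

Let itv0 t u : itv t u -> 0 <= u < 1.
Proof.
elim/last_ind: t => [|t x IHt /itv_rcons_sub]//.
by rewrite /itv /lo cylinder_mass_nil big_ord0 add0r.
Qed.

Let cylinder_path_of u t : 0 <= u < 1 -> cylinder t (path_of u) <-> itv t u.
Proof.
move=> u01; elim/last_ind: t => [|t x IHt].
  by rewrite /itv /lo cylinder_mass_nil big_ord0 add0r u01.
rewrite cylinder_rcons IHt; split=> [[tu]|xu].
  move: (tu); rewrite -IHt {1}/cylinder/= history_path_of /path_of => ->.
  rewrite /next; case: pickP => [y yu <-//|none].
  by have [y] := itv_rcons_ex tu; rewrite none.
have tu := itv_rcons_sub xu; split => //.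
move: (tu); rewrite -IHt {1}/cylinder/= history_path_of /path_of => ->.
rewrite /next; case: pickP => [y yu|none]; first exact: itv_rcons_inj yu xu.
by have := none x; rewrite xu.
Qed.

Let path_of_out u : ~~ (0 <= u < 1) -> path_of u = fun=> point.
Proof.
move=> uN; apply/funext => k; rewrite /path_of /next; case: pickP => //= x xu.
by rewrite (itv0 xu) in uN.
Qed.

Let measurable_path_of :
  measurable_fun [set: measurableTypeR R] (path_of : measurableTypeR R -> mpath X).
Proof.
apply: (@measurability _ _ (measurableTypeR R) (mpath X) setT path_of
  (@cylinders X)) => //.
move=> _ [_ [t _ <-] <-]; rewrite setTI.
(* Off [[0, 1)] the path is constant, so the preimage is the interval of [t], possibly joined with
   the whole complement of [[0, 1)]. *)
have -> : path_of @^-1` cylinder t =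
    `[lo t, lo t + cylinder_mass t[%classic `|`
    (~` `[0, 1[%classic `&` (fun=> cylinder t (fun=> point))).
  apply/seteqP; split=> u /=; rewrite !in_itv/=.
    have [u01|uN] := boolP (0 <= u < 1).
      by move=> /(cylinder_path_of _ u01); left.
    by rewrite path_of_out//; right.
  move=> [tu|[/negP uN]]; last by rewrite path_of_out.
  exact/(cylinder_path_of _ (itv0 tu)).
apply: measurableU; first exact: measurable_itv.
apply: measurableI; first by apply: measurableC; exact: measurable_itv.
have [ct|ct] := pselect (cylinder t (fun=> point)).
  by rewrite (_ : (fun=> _) = setT)//; apply/seteqP; split.
by rewrite (_ : (fun=> _) = set0)//; apply/seteqP; split.
Qed.

Let unit_itv := `[(0 : R), 1[%classic : set (measurableTypeR R).

Let munit_itv : measurable unit_itv. Proof. exact: measurable_itv. Qed.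

Let lebesgue01 : set (measurableTypeR R) -> \bar R :=
  mrestr lebesgue_measure munit_itv.

HB.instance Definition _ := Measure.on lebesgue01.

Let lebesgue01_setT : lebesgue01 setT = 1%E.
Proof.
rewrite /lebesgue01 /mrestr setTI lebesgue_measure_itv/= lte_fin ltr01.
by rewrite sube0.
Qed.

HB.instance Definition _ :=
  Measure_isProbability.Build _ _ _ lebesgue01 lebesgue01_setT.

HB.instance Definition _ :=
  isMeasurableFun.Build _ _ _ _ (path_of : measurableTypeR R -> mpath X)
    measurable_path_of.

(** The image of Lebesgue measure on [[0, 1)] under [path_of]: the path of [u] passes through [z]
    exactly when [u] lies in the interval of [z], whose length is [cylinder_mass z]. *)
Lemma probability_of_tree : exists mu : probability (mpath X) R,
  forall z, mu (cylinder z) = (cylinder_mass z)%:E.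
Proof.
exists (distribution lebesgue01 path_of) => z.
rewrite /distribution /pushforward /lebesgue01 /mrestr.
transitivity (lebesgue_measure `[lo z, lo z + cylinder_mass z[%classic).
  congr (lebesgue_measure _).
  apply/seteqP; split=> u /=; rewrite !in_itv/=.
    by move=> [+ u01]; rewrite cylinder_path_of.
  by move=> zu; have u01 := itv0 zu; rewrite cylinder_path_of.
rewrite lebesgue_measure_itv/= lte_fin; case: ltP => [_|].
  by rewrite -EFinD addrAC subrr add0r.
(* An empty interval: its mass is nonpositive, hence zero. *)
rewrite -[leRHS]addr0 lerD2l => le0; apply/esym/congr1/eqP.
by rewrite eq_le le0 cylinder_mass_ge0.
Qed.

End PathMeasure.

(** * Conditional path measures *)

Section PathMeasureSpec.
Context {R : realType} {X : pfinType}.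
Implicit Types (p : situation X -> X -> R) (s t z : situation X).

(** Conditioning on [s] amounts to making the tree follow [s] deterministically up to depth
    [size s], so the construction from the root serves every situation. The product splits there
    into an indicator of agreement with [s] and the conditional product. *)
Lemma cylinder_probE p s z : cylinder_prob p s z =
  cylinder_mass (fun t x => if (size t < size s)%N
    then (x == nth point s (size t))%:R else p t x) z.
Proof.
have prod_eq k : (k <= size s)%N -> (k <= size z)%N ->
    \prod_(0 <= i < k) ((nth point z i == nth point s i)%:R : R) =
    (take k z == take k s)%:R.
  move=> ks kz; have [eqk|neq] := eqVneq (take k z) (take k s).
    rewrite big_nat big1// => i /andP[_ ik].
    by rewrite -(nth_take _ ik) eqk nth_take// eqxx.
  apply/eqP; rewrite big_mkord prodf_seq_eq0; apply/hasP.
  apply: contrapT => none; move/eqP: neq; apply.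
  apply: (@eq_from_nth _ point); first by rewrite !size_takel.
  move=> i; rewrite size_takel// => ik; rewrite !nth_take//.
  apply/eqP; apply: contrapT => /negP neq; apply: none.
  exists (Ordinal ik); first by rewrite mem_index_enum.
  by rewrite /= (negbTE neq).
have -> : cylinder_mass (fun t x => if (size t < size s)%N
      then (x == nth point s (size t))%:R else p t x) z =
    \prod_(0 <= i < size z) (if (i < size s)%N
      then (nth point z i == nth point s i)%:R else p (take i z) (nth point z i)).
  rewrite /cylinder_mass big_mkord; apply: eq_bigr => i _.
  by rewrite size_takel// ltnW.
rewrite /cylinder_prob.
have [sz|zs] := ltnP (size s) (size z).
  rewrite [RHS](big_cat_nat (n := size s))//=; last exact: ltnW.
  rewrite [X in _ = X * _](eq_big_nat _ _
    (F2 := fun i => (nth point z i == nth point s i)%:R)); last first.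
    by move=> i /andP[_ ->].
  rewrite [X in _ = X * _]prod_eq ?(ltnW sz)// take_size; case: eqP => _ /=.
    by rewrite mul1r; apply: eq_big_nat => i /andP[si _]; rewrite ltnNge si.
  by rewrite mul0r; case: (leqP (size z) (size s)) => [zs|_];
    [move: sz; rewrite ltnNge zs|].
rewrite [RHS](eq_big_nat _ _
  (F2 := fun i => (nth point z i == nth point s i)%:R)); last first.
  by move=> i /andP[_ iz]; rewrite (leq_trans iz).
by rewrite [RHS]prod_eq// take_size eq_sym; case: eqP.
Qed.

Lemma path_measure_cylinder p s z : precise_tree p ->
  path_measure p s (cylinder z) = (cylinder_prob p s z)%:E.
Proof.
move=> hp; set p' := fun t x => if (size t < size s)%N
    then (x == nth point s (size t))%:R else p t x.
have hp' : precise_tree p'.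
  move=> t; rewrite /p'; case: ltnP => [_|_]; last exact: hp.
  split=> [x|]; first exact: ler0n.
  by rewrite (bigD1 (nth point s (size t)))//= eqxx big1 ?addr0// => x /negbTE ->.
have [mu muE] := probability_of_tree hp'.
have -> // : (forall z, path_measure p s (cylinder z) = (cylinder_prob p s z)%:E).
apply: (@getPex _ (fun mu : probability (mpath X) R =>
  forall z, mu (cylinder z) = (cylinder_prob p s z)%:E)).
by exists mu => z'; rewrite muE cylinder_probE.
Qed.

End PathMeasureSpec.

(** * Integral inequalities under a probability measure *)

Section ProbabilityIntegral.
Context d (T : measurableType d) (R : realType) (mu : probability T R).
Local Open Scope ereal_scope.
Implicit Types f g h : T -> \bar R.

(** Infinite integrals are covered by comparing positive parts, and negative parts in reverse. *)
Lemma le_integral_total f g : measurable_fun setT f -> measurable_fun setT g ->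
  (forall x, f x <= g x) -> \int[mu]_x f x <= \int[mu]_x g x.
Proof.
move=> mf mg fg; rewrite integralE [leRHS]integralE; apply: leeB.
  apply: ge0_le_integral => //; [exact: measurable_funepos|exact: measurable_funepos|].
  by move=> x _; apply: (@funepos_le _ _ setT f g) => //; rewrite inE.
apply: ge0_le_integral => //; [exact: measurable_funeneg|exact: measurable_funeneg|].
by move=> x _; apply: (@funeneg_le _ _ setT f g) => //; rewrite inE.
Qed.

Lemma integral_cst_probability (c : R) : \int[mu]_x (cst c%:E) x = c%:E.
Proof.
rewrite integral_cst// [X in _ * X](_ : _ = 1) ?mule1//.
exact: probability_setT.
Qed.

Lemma ge0_integral_addr_le h (c : R) : measurable_fun setT h ->
  (forall x, 0 <= h x) -> \int[mu]_x (h x + c%:E) <= \int[mu]_x h x + c%:E.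
Proof.
move=> mh h0; have [hoo|] := eqVneq (\int[mu]_x h x) +oo.
  by rewrite hoo addye// leey.
rewrite -ltey => hfin.
have ih : mu.-integrable setT h.
  apply/integrableP; split => //.
  by under eq_integral => x _ do rewrite gee0_abs//.
have ic : mu.-integrable setT (cst c%:E) by exact: finite_measure_integrable_cst.
by rewrite (integralD measurableT ih ic) integral_cst_probability.
Qed.

Lemma measurable_fun_limn_einf (f : (T -> \bar R)^nat) :
  (forall n, measurable_fun setT (f n)) ->
  measurable_fun setT (fun x => limn_einf (f ^~ x)).
Proof.
move=> mf; rewrite (_ : (fun _ => _) = (fun x => - limn_esup (fun n => - f n x))).
  apply: measurableT_comp => //; apply: measurable_fun_limn_esup => n.
  exact: measurableT_comp.
by apply/funext => x; rewrite limn_esupN oppeK.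
Qed.

(** Subtracting [c] reduces this to the nonnegative case of Fatou's lemma; integrability of each
    [f n] lets the constant be split off its integral again. *)
Lemma fatou_bounded_below (f : (T -> \bar R)^nat) (c : R) :
  (forall n, mu.-integrable setT (f n)) -> (forall n x, c%:E <= f n x) ->
  \int[mu]_x limn_einf (f ^~ x) <= limn_einf (fun n => \int[mu]_x f n x).
Proof.
move=> fint cf; have mf n : measurable_fun setT (f n) by exact: measurable_int (fint n).
pose g n x := (- c)%:E + f n x.
have mg n : measurable_fun setT (g n) by exact: emeasurable_funD.
have g0 n x : 0 <= g n x by rewrite /g EFinN addeC sube_ge0 ?cf.
have gE x : limn_einf (g ^~ x) = (- c)%:E + limn_einf (f ^~ x).
  exact: limn_einf_shift.
have fE x : limn_einf (f ^~ x) = limn_einf (g ^~ x) + c%:E.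
  by rewrite gE addeAC -EFinD addNr add0e.
under eq_integral do rewrite fE.
have h0 x : 0 <= limn_einf (g ^~ x).
  by rewrite limn_einf_lim; apply: lime_ge; [exact: is_cvg_einfs|];
    apply: nearW => n; apply: le_ereal_inf_tmp => _ [k _ <-].
apply: le_trans (ge0_integral_addr_le _ _ h0) _.
  exact: measurable_fun_limn_einf.
have := @fatou _ _ _ mu setT measurableT g mg (fun n x _ => g0 n x).
have ic : mu.-integrable setT (cst (- c)%:E) by exact: finite_measure_integrable_cst.
have -> : (fun n => \int[mu]_x g n x) = (fun n => (- c)%:E + \int[mu]_x f n x).
  apply/funext => n.
  by rewrite (integralD measurableT ic (fint n)) integral_cst_probability.
rewrite limn_einf_shift// => leg.
apply: le_trans (leeD2r _ leg) _.
by rewrite addeAC -EFinD addNr add0e.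
Qed.

End ProbabilityIntegral.

(** * Enumeration of the situations of a given length *)

Section Situations.
Context {X : pfinType}.
Implicit Types (w : paths X) (t z : situation X).

Fixpoint situations k : seq (situation X) :=
  if k is k'.+1 then [seq rcons t x | t <- situations k', x <- enum X] else [:: [::]].

Lemma size_situations k z : z \in situations k -> size z = k.
Proof.
elim: k z => [|k IHk] z /=; first by rewrite inE => /eqP ->.
by move=> /allpairsP[[t x] [/= /IHk tk _ ->]]; rewrite size_rcons tk.
Qed.

Lemma sum_situationsS (R : nmodType) k (F : situation X -> R) :
  \sum_(z <- situations k.+1) F z = \sum_(t <- situations k) \sum_x F (rcons t x).
Proof. by rewrite /= big_allpairs_dep; apply: eq_bigr => t _; rewrite big_enum. Qed.

(** Encodes that the list contains each situation of length [k] exactly once. *)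
Lemma sum_situations_pred1 (R : pzSemiRingType) k (F : situation X -> R) s :
  size s = k -> \sum_(z <- situations k) F z * (z == s)%:R = F s.
Proof.
elim: k s F => [|k IHk] s F.
  by move=> /size0nil ->; rewrite big_seq1 eqxx mulr1.
elim/last_ind: s => // s y _; rewrite size_rcons => -[sk].
rewrite sum_situationsS -(IHk s (fun t => F (rcons t y)) sk); apply: eq_bigr => t _.
rewrite (bigD1 y)//= big1 ?addr0 => [|x /negbTE xy]; rewrite eqseq_rcons.
  by rewrite eqxx andbT.
by rewrite xy andbF mulr0.
Qed.

Lemma measurable_cylinder t : measurable (cylinder t : set (mpath X)).
Proof. by apply: sub_sigma_algebra; exists t. Qed.

End Situations.

(** * Integrals of functions of the history *)

Section PathIntegral.
Context {R : realType} {X : pfinType}.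
Implicit Types (M : situation X -> R) (w : mpath X) (s t z : situation X).

(** As a finite combination of cylinder indicators, a function of the history inherits
    measurability, integrability and its integral from them. *)
Lemma historyE M w k :
  (M (history w k))%:E =
  (\sum_(z <- situations k) (M z)%:E * (\1_(cylinder z) w)%:E)%E.
Proof.
rewrite -(sum_situations_pred1 M (size_history w k)) -sumEFin.
apply: eq_big_seq => z /size_situations zk; rewrite EFinM; congr (_ * _%:E)%E.
rewrite indicE; congr ((nat_of_bool _)%:R); apply/idP/idP => [/eqP ->|].
  by rewrite inE; exact: cylinder_history.
by rewrite inE /cylinder/= zk => ->.
Qed.

Lemma integrable_history (mu : probability (mpath X) R) M k :
  mu.-integrable setT (fun w => (M (history w k))%:E).
Proof.
rewrite (funext (fun w => historyE M w k)).
apply: integrable_sum => // z _.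
by have := integrableZl measurableT (M z) (integrable_indic mu (measurable_cylinder z)).
Qed.

Lemma measurable_history M k :
  measurable_fun setT (fun w : mpath X => (M (history w k))%:E).
Proof.
rewrite (funext (fun w => historyE M w k)).
apply: emeasurable_sum => z; apply: measurable_funeM; apply/measurable_EFinP.
exact: measurable_indic (measurable_cylinder z).
Qed.

Lemma integral_history (mu : probability (mpath X) R) M k :
  (\int[mu]_w (M (history w k))%:E =
   \sum_(z <- situations k) (M z)%:E * mu (cylinder z))%E.
Proof.
rewrite (funext (fun w => historyE M w k)).
have ind z := integrable_indic mu (measurable_cylinder z).
rewrite integral_sum//; last by move=> z; exact: integrableZl.
apply: eq_bigr => z _; rewrite integralZl//; congr (_ * _)%E.
rewrite integral_indic ?setIT//; exact: measurable_cylinder.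
Qed.

Variables (p : situation X -> X -> R) (s : situation X).
Hypothesis hp : precise_tree p.
Let mu := path_measure p s.

Lemma cylinder_prob_ge0 z : 0 <= cylinder_prob p s z.
Proof.
rewrite cylinder_probE; apply: prodr_ge0 => i _; case: ifP => // _.
by case: (hp (take i z)).
Qed.

Lemma cylinder_prob_rcons z x : (size s <= size z)%N ->
  cylinder_prob p s (rcons z x) = cylinder_prob p s z * p z x.
Proof. by move=> sz; rewrite !cylinder_probE cylinder_mass_rcons ltnNge sz. Qed.

Lemma cylinder_prob_size z : size z = size s -> cylinder_prob p s z = (z == s)%:R.
Proof.
by move=> zs; rewrite /cylinder_prob zs ltnn leqnn/= take_size eq_sym; case: eqP.
Qed.

Definition path_mean M k := \sum_(z <- situations k) M z * cylinder_prob p s z.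

Lemma integral_path_mean M k : (\int[mu]_w (M (history w k))%:E = (path_mean M k)%:E)%E.
Proof.
rewrite integral_history -sumEFin; apply: eq_bigr => z _.
by rewrite path_measure_cylinder// EFinM.
Qed.

Lemma path_meanS M k : (size s <= k)%N ->
  path_mean M k.+1 = path_mean (fun t => mean (p t) (fun x => M (rcons t x))) k.
Proof.
move=> sk; rewrite /path_mean sum_situationsS; apply: eq_big_seq => t /size_situations tk.
rewrite /mean mulr_suml; apply: eq_bigr => x _.
by rewrite cylinder_prob_rcons ?tk// -mulrA; congr (_ * _); rewrite mulrC.
Qed.

Lemma path_mean_size M : path_mean M (size s) = M s.
Proof.
rewrite -[RHS](sum_situations_pred1 M (erefl (size s))).
by apply: eq_big_seq => z /size_situations zs; rewrite cylinder_prob_size.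
Qed.

(** Each averaging over the next state cannot increase the mean, and at depth [size s] all mass sits
    on [s]. *)
Lemma path_mean_supermartingale M k : (size s <= k)%N ->
  (forall t, mean (p t) (fun x => M (rcons t x)) <= M t) -> path_mean M k <= M s.
Proof.
move=> /subnKC <- Msup; elim: (k - size s)%N => [|n IHn].
  by rewrite addn0 path_mean_size.
rewrite addnS path_meanS ?leq_addr//; apply: le_trans IHn.
by apply: ler_sum => z _; rewrite ler_wpM2r ?cylinder_prob_ge0.
Qed.

Lemma integral_tree_value f W : tree_value (fun t => mean (p t)) f W ->
  (\int[mu]_w f w = (W s)%:E)%E.
Proof.
move=> [WE [N fW]]; pose k := (maxn N (size s)).
have sk : (size s <= k)%N := leq_maxr _ _.
have -> : f = fun w => (W (history w k))%:E.
  by apply/funext => w; apply: fW; exact: leq_maxl.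
rewrite integral_path_mean; congr _%:E; apply/eqP; rewrite eq_le.
rewrite path_mean_supermartingale//=; last by move=> t; rewrite -WE.
(* [W] is a martingale, so its negative is a supermartingale too and gives the reverse
   inequality. *)
have := path_mean_supermartingale sk (M := fun t => - W t).
rewrite /path_mean; under eq_bigr do rewrite mulNr.
rewrite sumrN lerN2; apply=> t; rewrite WE /mean -sumrN.
by apply: ler_sum => x _; rewrite mulNr.
Qed.

Lemma path_measure_start : mu (cylinder s) = 1%E.
Proof. by rewrite path_measure_cylinder// cylinder_prob_size// eqxx. Qed.

End PathIntegral.

(** * Limits of extended real sequences *)

Section LimInf.
Context {R : realType}.
Local Open Scope ereal_scope.
Implicit Types (u v : (\bar R)^nat) (a : \bar R).

Lemma limn_einf_le u a N : (forall n, (N <= n)%N -> u n <= a) -> limn_einf u <= a.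
Proof.
move=> ua; rewrite limn_einf_lim; apply: lime_le; first exact: is_cvg_einfs.
apply: nearW => n; apply: le_trans (ua (maxn N n) (leq_maxl _ _)).
by apply: ereal_inf_lbound; exists (maxn N n) => //=; exact: leq_maxr.
Qed.

Lemma limn_einf_ge u a N : (forall n, (N <= n)%N -> a <= u n) -> a <= limn_einf u.
Proof.
move=> au; rewrite limn_einf_lim; apply: lime_ge; first exact: is_cvg_einfs.
near=> n; apply: le_ereal_inf_tmp => _ [k /= nk <-]; apply: au.
by apply: leq_trans nk; near: n; exact: nbhs_infty_ge.
Unshelve. all: by end_near. Qed.

Lemma le_limn_esup u v : (forall n, u n <= v n) -> limn_esup u <= limn_esup v.
Proof.
move=> uv; rewrite !limn_esup_lim; apply: lee_lim; [exact: is_cvg_esups..|].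
apply: nearW => n; apply: ge_ereal_sup => _ [k nk <-]; apply: le_trans (uv k) _.
by apply: ereal_sup_ubound; exists k.
Qed.

(** The limit is the infimum of the sequence, and cutting below at [a] commutes with that
    infimum. *)
Lemma cvg_nonincreasing_maxe u l a : nonincreasing_seq u -> u @ \oo --> l ->
  (fun n => maxe (u n) a) @ \oo --> maxe l a.
Proof.
move=> udec ul.
have -> : l = ereal_inf (range u).
  by apply: cvg_unique ul _ => //; exact: ereal_nonincreasing_cvgn.
have maxdec : nonincreasing_seq (fun n => maxe (u n) a).
  by move=> m n mn; rewrite ge_max !le_max lexx orbT andbT udec.
have -> : maxe (ereal_inf (range u)) a = ereal_inf (range (fun n => maxe (u n) a)).
  apply/eqP; rewrite eq_le; apply/andP; split.
    apply: le_ereal_inf_tmp => _ [n _ <-].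
    rewrite ge_max !le_max lexx orbT andbT; apply/orP; left.
    by apply: ereal_inf_lbound; exists n.
  rewrite leNgt; apply/negP; rewrite gt_max => /andP[/ereal_inf_lt[_ [n _ <-] un] aI].
  have : ereal_inf (range (fun n => maxe (u n) a)) <= maxe (u n) a.
    by apply: ereal_inf_lbound; exists n.
  by rewrite leNgt gt_max un aI.
exact: ereal_nonincreasing_cvgn.
Qed.

End LimInf.

(** * Upper expectation of one precise tree *)

Section UpperExpectationPrecise.
Context {R : realType} {X : pfinType} (p : situation X -> X -> R).
Hypothesis hp : precise_tree p.
Implicit Types (f g : paths X -> \bar R) (s : situation X).
Local Open Scope ereal_scope.

Lemma upexp_precise_le f g s : (forall w, f w <= g w) ->
  upexp_precise p f s <= upexp_precise p g s.
Proof.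
move=> fg; apply: ereal_inf_le_tmp => _ [h [hb mh gh] <-].
by exists h => //; split => // w; apply: le_trans (fg w) (gh w).
Qed.

(** Such an [f] is its own smallest admissible majorant. *)
Lemma upexp_precise_measurable f s : bounded_below f ->
  measurable_fun [set: mpath X] f ->
  upexp_precise p f s = \int[path_measure p s]_w f w.
Proof.
move=> bf mf; apply/eqP; rewrite eq_le; apply/andP; split.
  by apply: ereal_inf_lbound; exists f.
apply: le_ereal_inf_tmp => _ [g [_ mg fg] <-].
exact: le_integral_total.
Qed.

Lemma tree_mean_exists f : finitary_gamble f ->
  exists W, tree_value (fun t => mean (p t)) f W.
Proof. by apply: tree_value_exists => t; exact: mean_tmono. Qed.

Lemma finitary_gamble_bounded_below f : finitary_gamble f -> bounded_below f.
Proof.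
move=> [_ [c fc]]; exists (- c)%R => w; have := fc w.
by case: (f w) => //= r; rewrite !lee_fin ler_norml => /andP[].
Qed.

Lemma finitary_gamble_integrable (mu : probability (mpath X) R) f :
  finitary_gamble f -> mu.-integrable setT f.
Proof.
move=> /tree_mean_exists[W [_ [N fW]]].
rewrite (_ : f = fun w => (W (history w N))%:E); first exact: integrable_history.
by apply/funext => w; exact: fW.
Qed.

Lemma finitary_gamble_measurable f :
  finitary_gamble f -> measurable_fun [set: mpath X] f.
Proof.
by move=> /(finitary_gamble_integrable (path_measure p [::])); exact: measurable_int.
Qed.

Lemma upexp_precise_finitary f s : finitary_gamble f ->
  upexp_precise p f s = \int[path_measure p s]_w f w.
Proof.
move=> ff; apply: upexp_precise_measurable.
  exact: finitary_gamble_bounded_below.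
exact: finitary_gamble_measurable.
Qed.

Lemma upexp_precise_tree_value f W s : tree_value (fun t => mean (p t)) f W ->
  upexp_precise p f s = (W s)%:E.
Proof.
move=> fW; rewrite upexp_precise_finitary; first exact: integral_tree_value.
exact: tree_value_finitary_gamble fW.
Qed.

(** The limit is bounded below and measurable, so its upper expectation is an integral to which
    Fatou's lemma applies. *)
Lemma upexp_precise_limit_le (f_ : nat -> paths X -> \bar R) f (c : R) s :
  (forall n, finitary_gamble (f_ n)) -> (forall n w, c%:E <= f_ n w) ->
  (forall w, f_ ^~ w @ \oo --> f w) ->
  upexp_precise p f s <= limn_einf (fun n => upexp_precise p (f_ n) s).
Proof.
move=> ff cf flim.
have fE : f = fun w => limn_einf (f_ ^~ w).
  by apply/funext => w; rewrite (cvg_limn_einf_sup (flim w)).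
rewrite upexp_precise_measurable; last 2 first.
- exists c => w; rewrite -(cvg_lim _ (flim w))//; apply: lime_ge.
    by apply/cvg_ex; exists (f w); exact: flim.
  exact: nearW.
- rewrite fE; apply: measurable_fun_limn_einf => n.
  exact: finitary_gamble_measurable.
rewrite (_ : (fun n => _) = (fun n => \int[path_measure p s]_w f_ n w)); last first.
  by apply/funext => n; exact: upexp_precise_finitary.
rewrite fE; apply: (@fatou_bounded_below _ (mpath X) R (path_measure p s) f_ c _ cf) => n.
exact: finitary_gamble_integrable.
Qed.

(** The limit [f] may be unbounded below, but a majorant [g] with lower bound [c] also dominates [f]
    cut at [c]. The cuts of the [f_ n] at [c] are uniformly bounded, and dominated convergence
    carries the bound [a] to their limit. *)
Lemma upexp_precise_nonincreasing_ge (f_ : nat -> paths X -> \bar R) f a s :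
  (forall n, finitary_gamble (f_ n)) -> (forall w, nonincreasing_seq (f_ ^~ w)) ->
  (forall w, f_ ^~ w @ \oo --> f w) ->
  (forall n, a <= upexp_precise p (f_ n) s) -> a <= upexp_precise p f s.
Proof.
move=> ff fdec flim af; apply: le_ereal_inf_tmp => _ [g [[c cg] mg fg] <-].
have [B f0B] : exists B : R, forall w, f_ 0%N w <= B%:E.
  by have [_ [B fB]] := ff 0%N; exists B => w; apply: le_trans (lee_abs _) (fB w).
have mf n := finitary_gamble_measurable (ff n).
pose h n w := maxe (f_ n w) c%:E.
have mh n : measurable_fun [set: mpath X] (h n) by exact: measurable_maxe.
have hlim w : h ^~ w @ \oo --> maxe (f w) c%:E.
  exact: cvg_nonincreasing_maxe.
have mfc : measurable_fun [set: mpath X] (fun w => maxe (f w) c%:E).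
  exact: emeasurable_fun_cvg mh (fun w _ => hlim w).
have hB n w : `|h n w| <= (`|B| + `|c|)%:E.
  have : h n w <= (Num.max B c)%:E.
    rewrite /h EFin_max ge_max !le_max lexx orbT andbT.
    by rewrite (le_trans (fdec w _ _ (leq0n n)) (f0B w)).
  have : c%:E <= h n w by rewrite le_max lexx orbT.
  case: (h n w) => // r; rewrite !lee_fin => cr rB.
  have B0 := normr_ge0 B; have Bn := ler_norm B; have c0 := ler_norm c.
  have c1 := ler_norm (- c).
  rewrite normrN in c1.
  rewrite ler_norml; apply/andP; split; first by lra.
  by move: rB; rewrite le_max => /orP[|] ?; lra.
have [_ _ intlim] := dominated_convergence (mu := path_measure p s) measurableT mh mfc
  (aeW _ (fun (w : mpath X) _ => hlim w))
  (finite_measure_integrable_cst _ (`|B| + `|c|) measurableT)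
  (aeW _ (fun (w : mpath X) n _ => hB n w)).
apply: (@le_trans _ _ (\int[path_measure p s]_w maxe (f w) c%:E)); last first.
  by apply: le_integral_total => // w; rewrite ge_max fg cg.
rewrite -(cvg_lim _ intlim)//; apply: lime_ge.
  by apply/cvg_ex; eexists; exact: intlim.
apply: nearW => n; apply: le_trans (af n) _.
rewrite upexp_precise_finitary//; apply: le_integral_total => // w.
by rewrite le_max lexx.
Qed.

End UpperExpectationPrecise.

(** The largest of finitely many thresholds makes an approximation chosen child by child uniform
    over the children. *)
Lemma finite_eventually (T : finType) (A : T -> nat -> Prop) :
  (forall x m n, (m <= n)%N -> A x m -> A x n) ->
  (forall x, exists m, A x m) -> exists m, forall x, A x m.
Proof.
move=> Amono /choice[m Am]; exists (\max_x m x)%N => x.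
exact: Amono x (m x) _ (leq_bigmax x) (Am x).
Qed.

(** * Compactness of credal sets *)

Section CredalSets.
Context {R : realType} {X : pfinType} (C : set (X -> R)).
Hypothesis hC : credal_set C.

(** A closed subset of the cube of functions into [[0, 1]], which is compact by Tychonoff's
    theorem. *)
Lemma credal_set_compact : compact (C : set {ptws X -> R}).
Proof.
have [_ Cmass Ccl _] := hC.
have cptI : compact [set q : {ptws X -> R} | forall x, `[0, 1]%classic (q x)].
  exact: (@tychonoff X (fun=> R) _ (fun=> @segment_compact R 0 1)).
apply: (subclosed_compact Ccl cptI) => q /Cmass mq x /=.
by rewrite in_itv/= mq.1 mass_function_le1.
Qed.

Lemma mean_continuous (u : X -> R) :
  continuous (fun q : {ptws X -> R} => mean q u : R).
Proof.
have cont x : xpredT x -> continuous (fun q : {ptws X -> R} => u x * q x : R).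
  move=> _ q.
  apply: (@continuous_comp {ptws X -> R} R R (fun q => q x) ( *%R (u x))).
    exact: (@proj_continuous X (fun=> R) x).
  exact: mulrl_continuous.
have addc : continuous (fun x : R * R => x.1 + x.2) by exact: add_continuous.
exact: (@continuous_big R X +%R 0 xpredT addc {ptws X -> R} (index_enum X) _ cont).
Qed.

(* A cluster point of near-maximizers of the [v m] over [C]. *)
Lemma nonincreasing_maximizer (U : (X -> R) -> R) (v : nat -> X -> R) :
  (forall u, U u = sup [set mean q u | q in C]) ->
  (forall x m n, (m <= n)%N -> v n x <= v m x) ->
  exists2 q, C q &
    forall m e, 0 < e -> exists n, U (v n) <= mean q (v m) + e.
Proof.
move=> hU vdec; have [_ Cmass _ _] := hC.
have [d [d0 dlim]] : exists d : nat -> R, (forall j, 0 < d j) /\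
    forall e, 0 < e -> exists N, forall j, (N <= j)%N -> d j < e.
  exists (fun j => j.+1%:R^-1); split=> [j|e e0]; first by rewrite invr_gt0.
  by have [N _ Ne] := near_infty_natSinv_lt (PosNum e0); exists N.
have approx j : exists q, C q /\ U (v j) <= mean q (v j) + d j.
  by have [q] := mean_approx_upper hC hU (v j) (d0 j); exists q.
have [qs qsP] := choice approx.
have [q [Cq clq]] : (C : set {ptws X -> R}) `&`
    cluster ((qs : nat -> {ptws X -> R}) @ \oo) !=set0.
  by apply: credal_set_compact; exists 0%N => // j _; case: (qsP j).
exists q => // m e e0.
have e20 : 0 < e / 2 by rewrite divr_gt0.
have [N Ne] := dlim _ e20.
(* Beyond [maxn m N] the tolerance is below [e / 2] and [v j] lies below [v m]; clustering at [q]
   costs the other [e / 2] in the mean of [v m]. *)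
have qs_tail : ((qs : nat -> {ptws X -> R}) @ \oo) (qs @` [set j | (maxn m N <= j)%N]).
  by exists (maxn m N) => // j mNj; exists j.
have q_nbhs : nbhs (q : {ptws X -> R}) [set q' | mean q' (v m) < mean q (v m) + e / 2].
  have lte : mean q (v m) < mean q (v m) + e / 2 by lra.
  exact: (@mean_continuous (v m) q _ (lt_nbhsl lte)).
have [_ [[j mNj <-] /= ltq]] := clq _ _ qs_tail q_nbhs.
exists j; have [Cqj leU] := qsP j.
have := Ne j (leq_trans (leq_maxr _ _) mNj).
have := tmono_le (mean_tmono (Cmass _ Cqj))
  (fun x => vdec x _ _ (leq_trans (leq_maxl _ _) mNj)).
by move=> /= ? ?; lra.
Qed.

End CredalSets.

(** * The measure-theoretic upper expectation on monotone limits *)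

Section Agreement.
Context {R : realType} {X : pfinType}.
Variables (P : situation X -> set (X -> R)) (Q : situation X -> (X -> R) -> R).
Hypotheses (hP : imprecise_tree P) (hPQ : agree P Q).
Implicit Types (f g h : paths X -> \bar R) (p : situation X -> X -> R).
Implicit Types (s t : situation X) (V W : situation X -> R).

Lemma agree_tmono t : translation_monotone (Q t).
Proof. exact: upper_tmono (hP t) (hPQ t). Qed.

Lemma agree_value_exists f : finitary_gamble f -> exists V, tree_value Q f V.
Proof. exact/tree_value_exists/agree_tmono. Qed.

Lemma agree_value_le f g V W s : tree_value Q f V -> tree_value Q g W ->
  (forall w, cylinder s w -> (f w <= g w)%E) -> V s <= W s.
Proof.
move=> fV gW; apply: (tree_value_le fV gW) => t u v.
exact: tmono_le (agree_tmono t).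
Qed.

Lemma agree_value_eq f g V W s : tree_value Q f V -> tree_value Q g W ->
  (forall w, cylinder s w -> f w = g w) -> V s = W s.
Proof. exact: tree_value_eq agree_tmono. Qed.

Lemma agree_value_cst f V s a : tree_value Q f V ->
  (forall w, cylinder s w -> f w = a%:E) -> V s = a.
Proof. move=> fV; exact: (agree_value_eq fV (tree_value_cst a agree_tmono)). Qed.

Lemma compatible_value_le p f V W s : compatible p P ->
  tree_value (fun t => mean (p t)) f W -> tree_value Q f V -> W s <= V s.
Proof.
move=> [hp pP] fW fV; apply: (tree_value_le fW fV) => // t u v uv.
apply: le_trans (tmono_le (agree_tmono t) uv).
exact: (mean_le_upper (C := P t) (U := Q t) (hP t) (hPQ t) u (pP t)).
Qed.

(* A single compatible tree does for all the [f_ n] what the infimum of the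
   upper values requires: [inf_m V m t <= W t], written without infima
   because the left-hand side may be [-oo]. *)
Lemma compatible_tree_nonincreasing (f_ : nat -> paths X -> \bar R)
    (V : nat -> situation X -> R) :
  (forall n, tree_value Q (f_ n) (V n)) -> (forall w, nonincreasing_seq (f_ ^~ w)) ->
  exists2 p, compatible p P &
    forall n W, tree_value (fun t => mean (p t)) (f_ n) W ->
    forall t e, 0 < e -> exists m, V m t <= W t + e.
Proof.
move=> fV fdec.
have Vdec t m n : (m <= n)%N -> V n t <= V m t.
  by move=> mn; apply: (agree_value_le (fV n) (fV m)) => w _; exact: fdec.
(* At each situation, one mass function serves all indices [m] at once. *)
have pex t : exists q, P t q /\ forall m e, 0 < e -> exists n,
    Q t (fun x => V n (rcons t x)) <= mean q (fun x => V m (rcons t x)) + e.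
  have [q Pq qV] := nonincreasing_maximizer (hP t) (v := fun n x => V n (rcons t x))
    (hPQ t) (fun x => Vdec (rcons t x)).
  by exists q.
have [p pP] := choice pex.
have hp : precise_tree p.
  by move=> t; have [_ Cmass _ _] := hP t; apply: Cmass; case: (pP t).
exists p; first by split=> // t; case: (pP t).
move=> n W [WE [N fW]]; have [_ [M fVn]] := fV n.
apply: (@size_down_ind X (maxn N M)) => [t|t IHt e e0].
  rewrite geq_max => /andP[leN leM] e e0; exists n.
  have := fW _ (nth point t) leN; rewrite (fVn _ _ leM) cylinder_nth => -[->].
  by rewrite lerDl ltW.
have e20 : 0 < e / 2 by rewrite divr_gt0.
(* Half of [e] goes to the children, through one index common to them all; the other half pays for
   the near-optimality of [p t] at that index. *)
have [m Vm] : exists m, forall x, V m (rcons t x) <= W (rcons t x) + e / 2.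
  apply: finite_eventually => [x i j ij|x]; last exact: IHt.
  exact/le_trans/Vdec.
have [m' Vm'] := (pP t).2 m _ e20.
exists m'; rewrite (fV m').1 WE; apply: le_trans Vm' _.
have := (mean_tmono (hp t)).2 _ _ _ Vm; lra.
Qed.

Lemma upexp_measure_le f g s : (forall w, (f w <= g w)%E) ->
  (upexp_measure P f s <= upexp_measure P g s)%E.
Proof.
move=> fg; apply: ge_ereal_sup => _ [p pP <-].
apply: le_trans (upexp_precise_le p s fg) _.
by apply: ereal_sup_ubound; exists p.
Qed.

Lemma upexp_precise_le_value p f V s : compatible p P -> tree_value Q f V ->
  (upexp_precise p f s <= (V s)%:E)%E.
Proof.
move=> pP fV; have [hp _] := pP.
have [W fW] := tree_mean_exists hp (tree_value_finitary_gamble fV).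
by rewrite (upexp_precise_tree_value hp s fW) lee_fin (compatible_value_le s pP fW fV).
Qed.

(** The upper bound holds because [f] lies below each [f_ n]. For the lower bound, a single
    compatible tree has all its values of the [f_ n] above the infimum, so the limit is taken inside
    one precise model. *)
Lemma upexp_measure_nonincreasing (f_ : nat -> paths X -> \bar R)
    (V : nat -> situation X -> R) f s :
  (forall n, tree_value Q (f_ n) (V n)) -> (forall w, nonincreasing_seq (f_ ^~ w)) ->
  (forall w, f_ ^~ w @ \oo --> f w) ->
  upexp_measure P f s = ereal_inf (range (fun n => (V n s)%:E)).
Proof.
move=> fV fdec flim; apply/eqP; rewrite eq_le; apply/andP; split.
  apply: le_ereal_inf_tmp => _ [n _ <-]; apply: ge_ereal_sup => _ [p pP <-].
  apply: le_trans (upexp_precise_le_value s pP (fV n)).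
  apply: upexp_precise_le => w; rewrite -(cvg_lim _ (flim w))//.
  apply: lime_le; first by apply/cvg_ex; exists (f w); exact: flim.
  by exists n => // m nm; exact: fdec.
have [p pP pV] := compatible_tree_nonincreasing fV fdec; have [hp _] := pP.
have ff n := tree_value_finitary_gamble (fV n).
apply: le_trans (_ : (upexp_precise p f s <= _)%E); last first.
  by apply: ereal_sup_ubound; exists p.
apply: (upexp_precise_nonincreasing_ge hp ff fdec flim) => n.
have [W fW] := tree_mean_exists hp (ff n).
rewrite (upexp_precise_tree_value hp s fW); apply/lee_addgt0Pr => e e0.
have [m Vm] := pV n W fW s e e0.
apply: le_trans (_ : ((V m s)%:E <= _)%E); last by rewrite -EFinD lee_fin.
by apply: ereal_inf_lbound; exists m.
Qed.

(** A constant sequence is nonincreasing, so one gamble is a special case of a limit. *)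
Lemma upexp_measure_value f V s : tree_value Q f V -> upexp_measure P f s = (V s)%:E.
Proof.
move=> fV.
rewrite (@upexp_measure_nonincreasing (fun=> f) (fun=> V) _ _ (fun=> fV)).
- rewrite (_ : range _ = [set (V s)%:E]) ?ereal_inf1//.
  by apply/seteqP; split=> [_ [n _ <-]//|_ ->]; exists 0%N.
- by move=> w m n _; exact: lexx.
- by move=> w; exact: (@cvg_cst _ (f w)).
Qed.

(** Fatou's lemma under each compatible tree gives the upper bound; the lower one is
    monotonicity. *)
Lemma upexp_measure_nondecreasing (f_ : nat -> paths X -> \bar R)
    (V : nat -> situation X -> R) f s :
  (forall n, tree_value Q (f_ n) (V n)) -> (forall w, nondecreasing_seq (f_ ^~ w)) ->
  (forall w, f_ ^~ w @ \oo --> f w) ->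
  upexp_measure P f s = ereal_sup (range (fun n => (V n s)%:E)).
Proof.
move=> fV finc flim; have ff n := tree_value_finitary_gamble (fV n).
apply/eqP; rewrite eq_le; apply/andP; split; last first.
  apply: ge_ereal_sup => _ [n _ <-]; rewrite -(upexp_measure_value s (fV n)).
  apply: upexp_measure_le => w; rewrite -(cvg_lim _ (flim w))//.
  apply: lime_ge; first by apply/cvg_ex; exists (f w); exact: flim.
  by exists n => // m nm; exact: finc.
apply: ge_ereal_sup => _ [p pP <-]; have [hp _] := pP.
have [c cf] := finitary_gamble_bounded_below (ff 0%N).
apply: le_trans (upexp_precise_limit_le (c := c) hp s ff _ flim) _.
  by move=> n w; apply: le_trans (cf w) (finc w _ _ (leq0n n)).
apply: (@limn_einf_le _ _ _ 0) => n _.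
apply: le_trans (upexp_precise_le_value s pP (fV n)) _.
by apply: ereal_sup_ubound; exists n.
Qed.

(** On finitary gambles the model is the recursion, which yields the first three axioms; the last
    two come from the precise models. *)
Lemma upexp_measure_axioms : upexp_axioms Q (upexp_measure P).
Proof.
have valueE f V : tree_value Q f V ->
    upexp_measure P f = fun s => (V s)%:E.
  by move=> fV; apply/funext => s; exact: upexp_measure_value.
split.
- move=> f s; have ff : finitary_gamble (fun w => (f (w (size s)))%:E).
    (* The state that follows [s] is the last entry of the history of length [(size s).+1]. *)
    have := finitary_gamble_history (fun t => f (last point t)) (size s).+1.
    by under [fun _ => _]eq_fun do rewrite historyS last_rcons.
  have [V fV] := agree_value_exists ff.
  rewrite (valueE _ _ fV) fV.1; congr (Q s _)%:E; apply/funext => x.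
  by apply: (agree_value_cst fV) => w /cylinder_rcons[_ ->].
- move=> f s ff; have [V fV] := agree_value_exists ff.
  have fIf : finitary_gamble (fun w => f w * (\1_(cylinder s) w)%:E)%E.
    have [_ [N fVN]] := fV.
    rewrite (_ : (fun w => _) = fun w =>
      (V (history w (maxn N (size s))) *
       (take (size s) (history w (maxn N (size s))) == s)%:R)%:E).
      exact: finitary_gamble_history (fun t => V t * (take (size s) t == s)%:R) _.
    apply/funext => w; rewrite (fVN (maxn N (size s)) w (leq_maxl _ _)) EFinM.
    rewrite take_history ?leq_maxr// indicE; congr (_ * (nat_of_bool _)%:R%:E)%E.
    by apply/idP/eqP; rewrite inE.
  have [W fW] := agree_value_exists fIf.
  rewrite (valueE _ _ fV) (valueE _ _ fW); congr _%:E.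
  apply: (agree_value_eq fV fW) => w sw.
  by rewrite indicE mem_set// mule1.
- move=> f k w /agree_value_exists[V fV]; rewrite (valueE _ _ fV).
  have gf : finitary_gamble (fun w' => (V (history w' k.+1))%:E : \bar R).
    exact: finitary_gamble_history.
  have [W gW] := agree_value_exists gf.
  rewrite (valueE _ _ gW) lee_fin fV.1 gW.1; apply: tmono_le (agree_tmono _) _ => x.
  rewrite (agree_value_cst (a := V (rcons (history w k) x)) gW)// => w'.
  by rewrite /cylinder/= size_rcons size_history => ->.
- by move=> f g s; exact: upexp_measure_le.
- move=> f_ f s ff [c cf] flim; apply: ge_ereal_sup => _ [p pP <-].
  have [hp _] := pP; apply: le_trans (upexp_precise_limit_le hp s ff cf flim) _.
  apply: le_trans (limn_einf_sup _) _; apply: le_limn_esup => n.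
  by apply: ereal_sup_ubound; exists p.
Qed.

End Agreement.

(** * The recursion bounds every model of the axioms *)

Section AxiomaticBound.
Context {R : realType} {X : pfinType} (Q : situation X -> (X -> R) -> R).
Hypothesis hQ : forall t, translation_monotone (Q t).
Variable E : global_upexp R X.
Hypothesis hE : upexp_axioms Q E.

Let E_eq_on_cylinder f g t : finitary_gamble f -> finitary_gamble g ->
  (forall w, cylinder t w -> f w = g w) -> E f t = E g t.
Proof.
move=> ff fg fgE; rewrite (upexp_conditional hE)// [RHS](upexp_conditional hE)//.
congr (E _ t); apply/funext => w; rewrite indicE.
have [/set_mem/fgE ->//|_] := boolP (w \in cylinder t); by rewrite !mule0.
Qed.

Let E_local t (v : X -> R) g : finitary_gamble g ->
  (forall w, cylinder t w -> g w = (v (w (size t)))%:E) -> E g t = (Q t v)%:E.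
Proof.
move=> fg gv; rewrite -(upexp_local hE); apply: E_eq_on_cylinder => //.
have := finitary_gamble_history (fun t => v (last point t)) (size t).+1.
by under [fun _ => _]eq_fun do rewrite historyS last_rcons.
Qed.

(** Induction on the number of levels left before depth [N], where [f] is constant on the cylinder.
    Otherwise [upexp_iterated] passes to the next level, monotonicity inserts the induction
    hypothesis, and [E_local] evaluates the result. *)
Lemma upexp_axioms_le_value f V t : tree_value Q f V -> (E f t <= (V t)%:E)%E.
Proof.
move=> fV; have ff := tree_value_finitary_gamble fV.
have [VE [N fVN]] := fV; have := leq_addl (size t) N.
move: {2}N => d; elim: d t => [|d IHd] t.
  rewrite addn0 => Nt; rewrite (@E_local t (fun=> V t))// ?tmono_cst// => w tw.
  by rewrite (fVN _ _ Nt) tw.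
(* The axiom speaks of histories; the path that pads [t] has [t] as its history of length
   [size t]. *)
move=> Nt; have := upexp_iterated hE (size t) (nth point t) ff.
rewrite cylinder_nth => /le_trans; apply.
apply: le_trans (_ : (E (fun w => (V (history w (size t).+1))%:E) t <= _)%E).
  apply: (upexp_monotone hE) => w; apply: IHd.
  by rewrite size_history addSn -addnS.
rewrite (@E_local t (fun x => V (rcons t x))) -?VE//.
  exact: finitary_gamble_history.
by move=> w tw; rewrite historyS tw.
Qed.

End AxiomaticBound.

(** * The game-theoretic upper expectation on monotone limits *)

Section Game.
Context {R : realType} {X : pfinType}.
Variables (P : situation X -> set (X -> R)) (Q : situation X -> (X -> R) -> R).
Hypotheses (hP : imprecise_tree P) (hPQ : agree P Q).
Implicit Types (f g h : paths X -> \bar R) (p : situation X -> X -> R) (s : situation X).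
Local Open Scope ereal_scope.

Let hQ t : translation_monotone (Q t) := agree_tmono hP hPQ t.

Lemma upexp_game_gamble_le f g s : (forall w, f w <= g w) ->
  upexp_game_gamble Q f s <= upexp_game_gamble Q g s.
Proof.
move=> fg; apply: ereal_inf_le_tmp => _ [M [Msup Mg] <-].
by exists M => //; split => // w sw; apply: le_trans (fg w) (Mg w sw).
Qed.

(** Under a compatible tree the means of [M] from depth [size s] on are at most [M s], and Fatou's
    lemma passes this to the inferior limit. *)
Lemma upexp_precise_le_supermartingale p M f s : compatible p P ->
  bounded_below_supermartingale Q M ->
  (forall w, cylinder s w -> f w <= limn_einf (fun k => (M (history w k))%:E)) ->
  upexp_precise p f s <= (M s)%:E.
Proof.
move=> [hp pP] [Msup [c cM]] fM; set mu := path_measure p s.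
have Msup_p t : (mean (p t) (fun x => M (rcons t x)) <= M t)%R.
  apply: le_trans (Msup t).
  exact: (mean_le_upper (C := P t) (U := Q t) (hP t) (hPQ t) _ (pP t)).
pose l (w : mpath X) := limn_einf (fun k => (M (history w k))%:E).
have cl w : c%:E <= l w.
  by apply: (@limn_einf_ge _ _ _ 0) => k _; rewrite lee_fin.
have ml : measurable_fun setT l.
  by apply: measurable_fun_limn_einf => k; exact: measurable_history.
(* The infinite term makes [g] majorize [f] off the cylinder as well, at no cost since that
   complement is a null set. *)
pose g (w : mpath X) := l w + +oo * (\1_(~` cylinder s) w)%:E.
have mcyl := measurable_cylinder s.
have mg : measurable_fun setT g.
  apply: emeasurable_funD => //; apply: measurable_funeM; apply/measurable_EFinP.
  exact: measurable_indic (measurableC mcyl).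
have gl w : cylinder s w -> g w = l w.
  move=> sw; rewrite /g indicE memNset ?mule0 ?adde0//; exact.
have goo w : ~ cylinder s w -> g w = +oo.
  move=> sw; rewrite /g indicE mem_set//= mule1 addey//.
  by rewrite -ltNye (lt_le_trans _ (cl w))// ltNyr.
have cg w : c%:E <= g w.
  by have [/gl ->|/goo ->] := pselect (cylinder s w); rewrite ?leey.
have fg w : f w <= g w.
  have [sw|/goo ->] := pselect (cylinder s w); last exact: leey.
  by rewrite gl//; exact: fM.
apply: le_trans (_ : \int[mu]_w g w <= _).
  by apply: ereal_inf_lbound; exists g => //; split => //; exists c.
have -> : \int[mu]_w g w = \int[mu]_w l w.
  apply: ae_eq_integral => //; exists (~` cylinder s); split.
  - exact: measurableC.
  - by have := probability_setC mu mcyl; rewrite path_measure_start// subee.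
  - by move=> w /= gw sw; apply: gw => _; exact: gl.
apply: le_trans (@fatou_bounded_below _ (mpath X) R mu
  (fun k w => (M (history w k))%:E) c _ _) _.
- by move=> k; exact: integrable_history.
- by move=> k w; rewrite lee_fin.
apply: (@limn_einf_le _ _ _ (size s)) => k sk.
by rewrite integral_path_mean// lee_fin path_mean_supermartingale.
Qed.

Lemma upexp_measure_le_game_gamble f s :
  upexp_measure P f s <= upexp_game_gamble Q f s.
Proof.
apply: ge_ereal_sup => _ [p pP <-]; apply: le_ereal_inf_tmp => _ [M [Msup fM] <-].
exact: upexp_precise_le_supermartingale.
Qed.

(* The witness is the supermartingale [sup_n (min (V n) c)], cut at [c] to be
   real-valued. *)
Lemma upexp_game_gamble_le_sup (f_ : nat -> paths X -> \bar R)
    (V : nat -> situation X -> R) f (c : R) s :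
  (forall n, tree_value Q (f_ n) (V n)) -> (forall w, nondecreasing_seq (f_ ^~ w)) ->
  (forall w, f w <= ereal_sup (range (f_ ^~ w))) -> (forall w, f w <= c%:E) ->
  upexp_game_gamble Q f s <= ereal_sup (range (fun n => (V n s)%:E)).
Proof.
move=> fV finc ffn fc.
have Vinc t m n : (m <= n)%N -> (V m t <= V n t)%R.
  by move=> mn; apply: (agree_value_le hP hPQ (fV m) (fV n)) => w _; exact: finc.
pose A t := range (fun n => Num.min (V n t) c).
have Aub t : has_ubound (A t) by exists c => _ [n _ <-]; rewrite ge_min lexx orbT.
have A0 t : A t !=set0 by exists (Num.min (V 0%N t) c), 0%N.
pose M t := sup (A t).
have VM n t : (Num.min (V n t) c <= M t)%R by apply: ub_le_sup => //; exists n.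
have Msup : supermartingale Q M.
  move=> t; apply/ler_addgt0Pr => e e0.
  (* One index nearly attains the suprema at all children together, so the supermartingale
     inequality reduces to that of [V n] cut at [c]. *)
  have [n Mn] : exists n, forall x,
      (M (rcons t x) <= Num.min (V n (rcons t x)) c + e)%R.
    apply: finite_eventually => [x i j ij Mi|x].
      by apply: le_trans Mi _; rewrite lerD2r le_min2// Vinc.
    have [_ [n _ <-] Mn] := sup_adherent e0 (conj (A0 (rcons t x)) (Aub _)).
    by exists n; rewrite -lerBlDr ltW.
  apply: le_trans ((hQ t).2 _ _ _ Mn) _; rewrite lerD2r.
  apply: le_trans (VM n t); rewrite le_min; apply/andP; split.
    by rewrite (fV n).1; apply: tmono_le (hQ t) _ => x; rewrite ge_min lexx.
  rewrite -[leRHS](tmono_cst c (hQ t)); apply: tmono_le (hQ t) _ => x.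
  by rewrite ge_min lexx orbT.
have [b bM] : exists b, forall t, (b <= M t)%R.
  have [b bf] := finitary_gamble_bounded_below (tree_value_finitary_gamble (fV 0%N)).
  exists (Num.min b c) => t; apply: le_trans (VM 0%N t); rewrite le_min2//.
  exact: (agree_value_le hP hPQ (tree_value_cst b hQ) (fV 0%N)).
apply: le_trans (_ : (M s)%:E <= _).
  apply: ereal_inf_lbound; exists M => //; split=> [|w _]; first by split=> //; exists b.
  (* Otherwise some [f_ n w] would exceed the inferior limit, and so would [c]; but beyond the depth
     of [f_ n], [M] is at least the smaller of the two. *)
  rewrite leNgt; apply/negP => liminf_lt.
  have [_ [n _ <-] ltfn] := ereal_sup_gt (lt_le_trans liminf_lt (ffn w)).
  have [_ [N fVn]] := fV n.
  have : mine (f_ n w) c%:E <= limn_einf (fun k => (M (history w k))%:E).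
    apply: (@limn_einf_ge _ _ _ N) => k Nk.
    by rewrite (fVn _ _ Nk) -EFin_min lee_fin.
  by rewrite leNgt lt_min ltfn (lt_le_trans liminf_lt (fc w)).
rewrite -ereal_sup_EFin//; apply: ge_ereal_sup => _ [_ [n _ <-] <-].
apply: le_ereal_sup_tmp; exists (V n s)%:E; first by exists n.
by rewrite lee_fin ge_min lexx.
Qed.

Lemma upexp_game_bbE f s : upexp_game_bb Q f s =
  ereal_sup (range (fun c : R => upexp_game_gamble Q (fun w => mine (f w) c%:E) s)).
Proof.
apply/cvg_lim => //; apply: nondecreasing_cvge => c d cd.
by apply: upexp_game_gamble_le => w; rewrite le_min2.
Qed.

Lemma upexp_gameE f s : upexp_game Q f s =
  ereal_inf (range (fun c : R => upexp_game_bb Q (fun w => maxe (f w) c%:E) s)).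
Proof.
set F := fun c : R => _; have Finc : {homo F : c d / (c <= d)%R >-> c <= d}.
  move=> c d cd; rewrite /F !upexp_game_bbE; apply: ge_ereal_sup => _ [c' _ <-].
  apply: le_ereal_sup_tmp; eexists; first by exists c'.
  by apply: upexp_game_gamble_le => w; rewrite le_min2// le_max2.
(* Composition with negation turns the limit at [-oo] into one at [+oo] of a nonincreasing
   function. *)
apply/cvg_lim => //; rewrite -/F; apply/cvgNy_compNP.
have -> : range F = range (F \o -%R).
  apply/seteqP; split=> _ [c _ <-]; last by exists (- c)%R.
  by exists (- c)%R => //=; rewrite opprK.
by apply: nonincreasing_cvge => c d cd; apply: Finc; rewrite lerN2.
Qed.

Lemma upexp_measure_le_game_bb f (b : R) s : (forall w, f w <= b%:E) ->
  upexp_measure P f s <= upexp_game_bb Q f s.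
Proof.
move=> fb; rewrite upexp_game_bbE; apply: le_ereal_sup_tmp.
exists (upexp_game_gamble Q (fun w => mine (f w) b%:E) s); first by exists b.
rewrite (_ : (fun w => _) = f); first exact: upexp_measure_le_game_gamble.
by apply/funext => w; rewrite min_l.
Qed.

(** A lower cut at a bound of [f_ 0] leaves [f] unchanged, and the supermartingale witness handles
    every upper cut. Conversely, [V n s] is the measure-theoretic value of [f_ n], which stays below
    [f] after any lower cut and after an upper cut at a bound of [f_ n]. *)
Lemma upexp_game_nondecreasing (f_ : nat -> paths X -> \bar R)
    (V : nat -> situation X -> R) f s :
  (forall n, tree_value Q (f_ n) (V n)) -> (forall w, nondecreasing_seq (f_ ^~ w)) ->
  (forall w, f_ ^~ w @ \oo --> f w) ->
  upexp_game Q f s = ereal_sup (range (fun n => (V n s)%:E)).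
Proof.
move=> fV finc flim.
have fE w : f w = ereal_sup (range (f_ ^~ w)).
  by apply: cvg_unique (flim w) _ => //; exact: ereal_nondecreasing_cvgn.
have ff n : finitary_gamble (f_ n) := tree_value_finitary_gamble (fV n).
rewrite upexp_gameE; apply/eqP; rewrite eq_le; apply/andP; split.
  have [b bf] := finitary_gamble_bounded_below (ff 0%N).
  apply: ereal_inf_le; eexists; first by exists b.
  rewrite upexp_game_bbE; apply: ge_ereal_sup => _ [c _ <-].
  apply: (upexp_game_gamble_le_sup s (c := c) fV finc) => w; last first.
    by rewrite ge_min lexx orbT.
  rewrite -fE ge_min; apply/orP; left; rewrite ge_max lexx/=.
  by apply: le_trans (bf w) _; rewrite fE; apply: ereal_sup_ubound; exists 0%N.
apply: ge_ereal_sup => _ [n _ <-]; apply: le_ereal_inf_tmp => _ [c _ <-].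
rewrite -(upexp_measure_value hP hPQ s (fV n)) upexp_game_bbE.
have [b fb] : exists b : R, forall w, f_ n w <= b%:E.
  by have [_ [b fb]] := ff n; exists b => w; apply: le_trans (lee_abs _) (fb w).
apply: le_ereal_sup_tmp; eexists; first by exists b.
apply: le_trans (upexp_measure_le_game_gamble _ s).
apply: upexp_measure_le => w; rewrite le_min fb andbT le_max; apply/orP; left.
by rewrite fE; apply: ereal_sup_ubound; exists n.
Qed.

(** Cut below at a lower bound of [f_ n], [f] still lies under [f_ n], and the witness for the
    constant sequence [f_ n] gives the upper bound. The lower bound comes from the measure-theoretic
    value, since every lower cut of [f] is bounded above. *)
Lemma upexp_game_nonincreasing (f_ : nat -> paths X -> \bar R)
    (V : nat -> situation X -> R) f s :
  (forall n, tree_value Q (f_ n) (V n)) -> (forall w, nonincreasing_seq (f_ ^~ w)) ->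
  (forall w, f_ ^~ w @ \oo --> f w) ->
  upexp_game Q f s = ereal_inf (range (fun n => (V n s)%:E)).
Proof.
move=> fV fdec flim.
have fle n w : f w <= f_ n w.
  have -> : f w = ereal_inf (range (f_ ^~ w)).
    by apply: cvg_unique (flim w) _ => //; exact: ereal_nonincreasing_cvgn.
  by apply: ereal_inf_lbound; exists n.
have ff n : finitary_gamble (f_ n) := tree_value_finitary_gamble (fV n).
rewrite upexp_gameE; apply/eqP; rewrite eq_le; apply/andP; split.
  apply: le_ereal_inf_tmp => _ [n _ <-].
  have [b bf] := finitary_gamble_bounded_below (ff n).
  apply: ereal_inf_le; eexists; first by exists b.
  rewrite upexp_game_bbE; apply: ge_ereal_sup => _ [c _ <-].
  apply: le_trans (@upexp_game_gamble_le_sup (fun=> f_ n) (fun=> V n) _ c s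
    (fun=> fV n) _ _ _) _ => [w i j _|w|w|]; first exact: lexx.
  - apply: le_ereal_sup_tmp; exists (f_ n w); first by exists 0%N.
    by rewrite ge_min ge_max fle bf.
  - by rewrite ge_min lexx orbT.
  - by apply: ge_ereal_sup => _ [_ _ <-].
rewrite -(upexp_measure_nonincreasing hP hPQ s fV fdec flim).
apply: le_ereal_inf_tmp => _ [c _ <-].
have [b fb] : exists b : R, forall w, f_ 0%N w <= b%:E.
  by have [_ [b fb]] := ff 0%N; exists b => w; apply: le_trans (lee_abs _) (fb w).
apply: le_trans (@upexp_measure_le_game_bb _ (Num.max b c) s _).
  by apply: upexp_measure_le => w; rewrite le_max lexx.
by move=> w; rewrite EFin_max le_max2// (le_trans (fle 0%N w)).
Qed.

End Game.

(** * Equality of the upper expectations *)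

Unset Implicit Arguments.

Theorem theorem7 (R : realType) (X : pfinType)
    (P : situation X -> set (X -> R)) (Q : situation X -> (X -> R) -> R)
    (hP : imprecise_tree P) (hQ : upexp_tree Q) (hPQ : agree P Q)
    (s : situation X) (f : paths X -> \bar R) (f_ : nat -> paths X -> \bar R)
    (hfin : forall n, finitary_gamble (f_ n))
    (hmono : (forall w, nondecreasing_seq (f_ ^~ w)) \/
             (forall w, nonincreasing_seq (f_ ^~ w)))
    (hlim : forall w, f_ ^~ w @ \oo --> f w) :
  upexp_measure P f s = upexp_game Q f s /\
  (forall E : global_upexp R X,
     upexp_axiomatic Q E -> upexp_measure P f s = E f s).
Proof.
have [V fV] := choice (fun n => agree_value_exists hP hPQ (hfin n)).
have hQt := agree_tmono hP hPQ.
split.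
  case: hmono => [finc|fdec].
    by rewrite (upexp_measure_nondecreasing hP hPQ s fV finc hlim)
      (upexp_game_nondecreasing hP hPQ s fV finc hlim).
  by rewrite (upexp_measure_nonincreasing hP hPQ s fV fdec hlim)
    (upexp_game_nonincreasing hP hPQ s fV fdec hlim).
(* Maximality of [E] gives one inequality, because the measure-theoretic model satisfies the
   axioms. *)
move=> E [hE Emax]; apply/eqP; rewrite eq_le Emax ?andTb; last first.
  exact: upexp_measure_axioms.
(* For the other, [E] is at most [V n s] on each [f_ n]; [upexp_continuous] transfers this to
   nondecreasing limits and [upexp_monotone] to nonincreasing ones. *)
case: hmono => [finc|fdec].
  rewrite (upexp_measure_nondecreasing hP hPQ s fV finc hlim).
  have [c cf] := finitary_gamble_bounded_below (hfin 0%N).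
  apply: le_trans (upexp_continuous hE s hfin _ hlim) _.
    by exists c => n w; apply: le_trans (cf w) (finc w _ _ (leq0n n)).
  rewrite limn_esup_lim; apply: lime_le; first exact: is_cvg_esups.
  apply: nearW => n; apply: ge_ereal_sup => _ [k _ <-].
  apply: le_trans (upexp_axioms_le_value hQt hE s (fV k)) _.
  by apply: ereal_sup_ubound; exists k.
rewrite (upexp_measure_nonincreasing hP hPQ s fV fdec hlim).
apply: le_ereal_inf_tmp => _ [n _ <-].
apply: le_trans (upexp_axioms_le_value hQt hE s (fV n)).
apply: (upexp_monotone hE) => w.
have -> : f w = ereal_inf (range (f_ ^~ w)).
  by apply: cvg_unique (hlim w) _ => //; exact: ereal_nonincreasing_cvgn.
by apply: ereal_inf_lbound; exists n.
Qed.
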